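(* Let $q_\theta$ be the output density on $\mathbb{R}^d$ of a normalizing flow $x = T(z)$, and assume that the input distribution $q_z$ of $z$ is the standard normal distribution on $\mathbb{R}^d$. Assume that $T^{-1}(x) = G^{(k)}\circ\cdots\circ G^{(1)}(x)$ is a composition of $k$ coupling layers, where each layer $G^{(i)}:\mathbb{R}^d\to\mathbb{R}^d$, $x^{(i)}\mapsto x^{(i+1)}$ (with $x^{(1)}=x$ and $x^{(k+1)}=z$), is given by $$G^{(i)}_j\big(x^{(i)}_j, x^{(i)}_{<j}\big) = \varphi^{(i)}_j\big(x^{(i)}_{<j}\big)\, x^{(i)}_j + \eta^{(i)}_j\big(x^{(i)}_{<j}\big),\qquad j=1,\dots,d.$$ Suppose that, for all $i$ and $j$, $\varphi^{(i)}_j$ is a constant function, $\eta^{(i)}_j$ is Lipschitz, and for all $r<j$ the partial derivative $\frac{\partial \eta^{(i)}_j}{\partial x_r}$ is well-defined almost everywhere and piecewise constant on $\mathbb{R}$. Then $\nabla\log q_\theta(x)$ is Lipschitz continuous on $\mathbb{R}^d$.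
   Context: A normalizing flow is a map $T:\mathbb{R}^d\to\mathbb{R}^d$ that is invertible with both $T$ and $T^{-1}$ differentiable, applied to a latent variable $z\in\mathbb{R}^d$ with density $q_z$. Its output density (the density of $x=T(z)$) is $q_\theta(x) = q_z\big(T^{-1}(x)\big)\,\big|\det J_{T^{-1}}(x)\big|$, where $J_{T^{-1}}(x)$ is the $d\times d$ Jacobian matrix of $T^{-1}$ at $x$; the subscript $\theta$ denotes the (fixed) parameters of the network realizing $T$, and $\log q_\theta$ is taken to be differentiable. For a vector $x\in\mathbb{R}^d$, $x_j$ is its $j$-th entry and $x_{<j}=(x_1,\dots,x_{j-1})$ collects the entries before it (empty for $j=1$); $G^{(i)}_j$ is the $j$-th component of $G^{(i)}$; $\varphi^{(i)}_j$ and $\eta^{(i)}_j$ are real-valued functions of $x^{(i)}_{<j}$. *)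

(* Defs.v *)
From mathcomp Require Import all_boot all_order all_algebra.
From mathcomp Require Import all_classical all_reals all_analysis.

Set Implicit Arguments.
Unset Strict Implicit.
Unset Printing Implicit Defensive.

Import Order.TTheory GRing.Theory Num.Theory.
Import numFieldNormedType.Exports.

Local Open Scope classical_set_scope.
Local Open Scope ring_scope.

(* Vectors of R^n are row vectors, indexed from 0. The library norm on them is
   the sup norm, so [lipschitz] below is with respect to it; being Lipschitz
   does not depend on the choice of a norm on R^n. *)

(* Lebesgue-null sets of R^n, by countable covers with closed boxes. (For n = 0
   no cover has a small volume; the definition is meant for n > 0.) *)
Definition lebesgue_null (R : realType) (n : nat) (A : set 'rV[R]_n) : Prop :=
  forall e : R, 0 < e ->
  exists a b : nat -> 'rV[R]_n,
    [/\ forall m i, a m 0 i <= b m 0 i,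
        A `<=` \bigcup_m [set x : 'rV[R]_n | forall i, a m 0 i <= x 0 i <= b m 0 i] &
        (\sum_(0 <= m <oo) (\prod_(i < n) (b m 0 i - a m 0 i))%:E <= e%:E)%E].

Definition locally_finite (R : realType) (n : nat)
    (P : nat -> set 'rV[R]_n) : Prop :=
  forall x : 'rV[R]_n, exists2 U, nbhs x U & finite_set [set m | P m `&` U !=set0].

(* A function f whose domain of definition is D is piecewise constant when
   R^n is covered, up to a null set, by a locally finite family of open pieces
   (in particular by finitely many, as pieces may be empty) such that f takes a
   single value on the points of D in each piece. Open sets up to a null set
   account for the arbitrary values on the boundaries between the pieces. *)
Definition piecewise_constant (R : realType) (n : nat)
    (D : set 'rV[R]_n) (f : 'rV[R]_n -> R) : Prop :=
  exists (P : nat -> set 'rV[R]_n) (c : nat -> R),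
    [/\ forall m, open (P m),
        locally_finite P,
        lebesgue_null (~` \bigcup_m P m) &
        forall m x, P m x -> D x -> f x = c m].

(* derivable_partial f r is the domain of definition of partial f r; outside of
   it the latter is a junk value. *)
Definition derivable_partial (R : realType) (n : nat) (f : 'rV[R]_n -> R)
    (r : 'I_n) : set 'rV[R]_n :=
  [set x | derivable f x (delta_mx 0 r)].

Definition partial (R : realType) (n : nat) (f : 'rV[R]_n -> R) (r : 'I_n)
    (x : 'rV[R]_n) : R :=
  'D_(delta_mx 0 r) f x.

Definition gradient (R : realType) (n : nat) (f : 'rV[R]_n -> R)
    (x : 'rV[R]_n) : 'rV[R]_n :=
  \row_(r < n) partial f r x.

(* x_{<j}: since indices start at 0, there are exactly j entries before x_j. *)
Definition before (R : realType) (d : nat) (j : 'I_d) (x : 'rV[R]_d) : 'rV[R]_j :=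
  \row_(r < j) x 0 (widen_ord (ltnW (ltn_ord j)) r).

Definition coupling_layer (R : realType) (d : nat)
    (phi eta : forall j : 'I_d, 'rV[R]_j -> R) (x : 'rV[R]_d) : 'rV[R]_d :=
  \row_(j < d) (phi j (before j x) * x 0 j + eta j (before j x)).

(* G^(k) o ... o G^(1); the layer of index 0 is applied first. *)
Definition compose_layers (T : Type) (k : nat) (G : 'I_k -> T -> T) (x : T) : T :=
  foldl (fun y i => G i y) x (enum 'I_k).

Definition standard_normal_density (R : realType) (d : nat) (z : 'rV[R]_d) : R :=
  \prod_(j < d) normal_pdf 0 1 (z 0 j).

(* The library's jacobian acts on row vectors, hence is the transpose of the
   usual one; this does not affect its determinant. *)
Definition flow_density (R : realType) (d : nat) (qz : 'rV[R]_d -> R)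
    (Tinv : 'rV[R]_d -> 'rV[R]_d) (x : 'rV[R]_d) : R :=
  qz (Tinv x) * `|\det ('J Tinv x)|.

(* Main.v *)
Require Import Defs.
From mathcomp Require Import all_boot all_order all_algebra.
From mathcomp Require Import all_classical all_reals all_analysis.
From mathcomp Require Import perm measurable_realfun.
From mathcomp Require Import ring lra.

Set Implicit Arguments.
Unset Strict Implicit.
Unset Printing Implicit Defensive.

Import Order.TTheory GRing.Theory Num.Theory.
Import numFieldNormedType.Exports.

Local Open Scope classical_set_scope.
Local Open Scope ring_scope.

(** The theorem holds because T^-1 is an affine map. The log-density is then a
    constant minus half of the sum of the squares of affine functions, its
    gradient is an affine map, and affine maps are Lipschitz.

    The layers need not be affine: eta may be an absolute value, or even have
    kinks that accumulate. Affinity comes from the differentiability of T^-1 at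
    every point. In one variable, a Lipschitz function that has a derivative at
    every point, this derivative taking almost everywhere one of finitely many
    values, is affine [affine_of_finite_derivative]. The intermediate value
    property of derivatives is not enough for this, because the values on a null
    set are not controlled. The proof excludes a function whose derivative is
    a.e. of absolute value at least d and which goes both up and down
    [steep_not_zigzag]: it would have nested intervals shrinking to a point on
    which the mean slopes are at least d/2 and at most -d/2 in turn, and could
    not be differentiable at that point.

    In several variables, almost everywhere is taken in the iterated sense
    [AE]: for a.e. x_0, for a.e. x_1, and so on. Null sets in the sense of box
    covers have a complement that is full in this sense, by slicing
    [lebesgue_null_AE]. The order of the quantifiers is the one of the triangular
    structure: when x_0 .. x_(j-1) are fixed, a coupling layer acts on x_j by an
    affine bijection of the line, and this preserves null sets. Hence full sets
    can be pulled back along the layers [AE_coupling_layer], with no change of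
    variables in R^d. The scales phi do not vanish because T^-1 is onto
    [coupling_layer_surj_neq0].

    The class of functions that is followed through the layers is [ae_affine]:
    around almost every point the function is affine, with slope entries in a list
    that can be chosen locally uniformly. The functions eta belong to it
    [piecewise_constant_ae_affine], and it is stable under composition
    [ae_affine_comp]. A Lipschitz member that has partial derivatives everywhere
    is affine [affine_of_ae_affine], by induction on the dimension: on a dense
    set of lines in the last direction the one-variable result applies; the slope
    on these lines is continuous and takes finitely many values locally, hence is
    a constant s; what remains is a function of the other variables, to which the
    induction hypothesis applies. *)

(** * Almost every real number *)

(** The measurable type of the Lebesgue measure is a copy of R; this definition
    lets sets and filters be stated on R itself. *)
Definition aeR (R : realType) : set_system R :=
  almost_everywhere (@lebesgue_measure R).

Global Instance aeR_filter (R : realType) : Filter (@aeR R).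
Proof. exact: (ae_filter_ringOfSetsType (@lebesgue_measure R)). Qed.

Lemma aeR_ex_itv (R : realType) (P : set R) (a b : R) :
  a < b -> aeR P -> exists2 t, a < t < b & P t.
Proof.
move=> ab [N [mN N0 PN]]; apply: contrapT => nP.
have abN : `]a, b[ `<=` N.
  move=> t; rewrite /= in_itv /= => tab; apply: PN => Pt.
  by apply: nP; exists t.
have : (lebesgue_measure `]a, b[ <= lebesgue_measure N)%E.
  by apply: le_measure; rewrite ?inE.
rewrite N0 lebesgue_measure_itv /= lte_fin ab -EFinD lee_fin subr_le0 leNgt.
by rewrite ab.
Qed.

(** The image of the Lebesgue measure under an affine bijection is a multiple of
    the Lebesgue measure, as can be checked on intervals. *)
Lemma aeR_comp_affine (R : realType) (P : set R) (c e : R) :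
  c != 0 -> aeR P -> aeR (fun t => P (c * t + e)).
Proof.
move=> c0 [N [mN N0 PN]].
pose f : measurableTypeR R -> measurableTypeR R := fun t => c * t + e.
have mf : measurable_fun setT f.
  by apply: measurable_funD => //; exact: measurable_funM.
exists (f @^-1` N); split; last by move=> t Pt; apply: PN.
  by rewrite -[X in measurable X]setTI; exact: mf.
have cp : 0 < `|c| by rewrite normr_gt0.
pose mu0 := mscale (NngNum (ltW cp)) (pushforward (@lebesgue_measure R) f).
pose mu := mu0 mf.
have muE (X : set R) : ocitv X -> lebesgue_measure X = mu X.
  move=> [[a b]] _ <-; rewrite /mu /mu0 /mscale /= /pushforward lebesgue_measure_itv /= lte_fin.
  have [c_gt0|c_lt0|c_eq0] := ltgtP 0 c; last by rewrite -c_eq0 eqxx in c0.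
    have -> : f @^-1` `]a, b]%classic = `](a - e) / c, (b - e) / c]%classic.
      apply/seteqP; split=> t; rewrite /f /= !in_itv /= ltr_pdivrMr // ler_pdivlMr //;
        by rewrite ltrBlDr lerBrDr mulrC.
    rewrite lebesgue_measure_itv /= lte_fin ltr_pM2r ?invr_gt0 // ltrD2r.
    case: ifP => _; last by rewrite mule0.
    by rewrite -!EFinD -EFinM gtr0_norm //; congr (_%:E); field.
  have -> : f @^-1` `]a, b]%classic = `[(b - e) / c, (a - e) / c[%classic.
    apply/seteqP; split=> t; rewrite /f /= !in_itv /= ltr_ndivlMr // ler_ndivrMr //;
      by rewrite ltrBlDr lerBrDr [t * c]mulrC andbC.
  rewrite lebesgue_measure_itv /= lte_fin ltr_nM2r ?invr_lt0 // ltrD2r.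
  case: ifP => _; last by rewrite mule0.
  rewrite -!EFinD -EFinM ltr0_norm //; congr (_%:E); field; exact: c0.
have := lebesgue_measure_unique muE mN.
rewrite N0 /mu /mu0 /mscale /= /pushforward => /esym/eqP.
rewrite mule_eq0 => /orP[|/eqP //].
by rewrite eqe normr_eq0 (negbTE c0).
Qed.

(** * Monotonicity from the sign of the derivative almost everywhere *)

(** Real induction: the supremum of the points of A in the interval is a last one,
    provided that A contains the limits from the left of its points. *)
Lemma interval_last (R : realType) (A : set R) (u v : R) :
  u <= v -> A u -> ~ A v ->
  (forall s, u <= s <= v ->
     (forall e, 0 < e -> exists2 t, s - e < t <= s & u <= t /\ A t) -> A s) ->
  exists2 s, u <= s < v & A s /\ forall t, s < t <= v -> ~ A t.
Proof.
move=> uv Au nAv Acl.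
pose B := [set t | u <= t <= v /\ A t].
have Bu : B u by split; rewrite ?lexx.
have supB : has_sup B.
  by split; [exists u|exists v => t [/andP[]]].
have us : u <= sup B by apply: ub_le_sup => //; case: supB.
have sv : sup B <= v by apply: ge_sup; [exists u|move=> t [/andP[]]].
have As : A (sup B).
  apply: Acl; first by rewrite us.
  move=> e e0; have [t Bt st] := sup_adherent e0 supB.
  exists t; last by case: Bt => /andP[].
  by rewrite st; apply: ub_le_sup => //; case: supB.
exists (sup B).
  by rewrite us lt_neqAle sv andbT; apply: contra_notN nAv => /eqP <-.
split=> // t /andP[st tv] At; have : t <= sup B; last by rewrite leNgt st.
by apply: ub_le_sup; [case: supB|split=> //; rewrite tv (le_trans us (ltW st))].
Qed.

Lemma derivable_expansion (R : realType) (h : R -> R) (t e : R) :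
  derivable h t 1 -> 0 < e ->
  \forall s \near t, `|h s - h t - 'D_1 h t * (s - t)| <= e * `|s - t|.
Proof.
move=> dh e0.
have /cvgrPdist_le /(_ e e0) :
    (fun d => d^-1 *: (h (d *: 1 + t) - h t)) @ 0^' --> 'D_1 h t.
  exact: dh.
case/nbhs_ballP => d /= d0 H; apply/nbhs_ballP; exists d => //= s.
rewrite /ball /= distrC => sd.
have [->|st] := eqVneq s t; first by rewrite !subrr mulr0 subrr normr0 mulr0.
have st0 : s - t != 0 by rewrite subr_eq0.
have := H (s - t); rewrite /ball /= sub0r normrN => /(_ sd st0).
rewrite /GRing.scale /= mulr1 subrK => H1.
rewrite -ler_pdivrMr ?normr_gt0 // -normfV -normrM mulrBl mulfK // mulrC.
by rewrite distrC.
Qed.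

Lemma aeR_neq (R : realType) (x : R) : aeR (fun t => t != x).
Proof.
exists [set x]; split; [exact: measurable_set1|exact: lebesgue_measure_set1|].
by move=> t /= /negP; rewrite negbK => /eqP.
Qed.

(** The exceptional null set is covered by an open set U of measure less than e.
    Adding to h the function e (t - u) + K mu(U, ]u, t]), which is small, makes
    up for the decrease of h: outside of U the first term wins against a
    nonnegative derivative, and in U the second one wins against the Lipschitz
    bound. So the sum Phi can be continued upwards from every point. *)
Lemma lipschitz_ae_nondecreasing (R : realType) (h : R -> R) (K u v : R) :
  u <= v -> (forall s t, `|h s - h t| <= K * `|s - t|) ->
  aeR (fun t => u < t < v -> derivable h t 1 /\ 0 <= 'D_1 h t) -> h u <= h v.
Proof.
move=> uv hK h'ge0.
have [N [mN N0 HN]] :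
    aeR (fun t => u <= t < v -> derivable h t 1 /\ 0 <= 'D_1 h t).
  apply: filterS2 h'ge0 (aeR_neq u) => t ht /eqP tu /andP[ut tv]; apply: ht.
  by rewrite tv andbT lt_neqAle ut andbT eq_sym; apply/eqP.
have K0 : 0 <= K by have := hK 1 0; rewrite subr0 normr1 mulr1; apply: le_trans.
pose mu : set R -> \bar R := @lebesgue_measure R.
have mu_le (A B : set R) : measurable A -> measurable B -> A `<=` B ->
    (mu A <= mu B)%E.
  by move=> mA mB AB; apply: (le_measure (@lebesgue_measure R)) => //; rewrite inE.
suff H e : 0 < e -> h u <= h v + e * ((v - u) + K).
  have C0 : 0 < (v - u) + K + 1 by rewrite ltr_wpDl // addr_ge0 // subr_ge0.
  apply/ler_addgt0Pr => e e0; apply: le_trans (H (e / ((v - u) + K + 1)) _) _.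
    by rewrite divr_gt0.
  rewrite lerD2l mulrAC ler_pdivrMr // ler_pM2l // lerDl //.
move=> e0.
have [U [Uop NU Ue]] : exists U : set R, [/\ open U, N `<=` U & (mu U < e%:E)%E].
  have N0' : (mu N < +oo)%E by rewrite /mu N0.
  have [U [Uop NU UNe]] := lebesgue_regularity_outer mN N0' e0.
  exists U; split=> //; rewrite -(setDUK NU) (le_lt_trans _ UNe) //.
  apply: le_trans (measureU2 _ _ _) _ => //.
    by apply: measurableD => //; exact: open_measurable.
  by rewrite /mu [X in (X + _)%E]N0 add0e.
have mU : measurable U by exact: open_measurable.
have mUt t : measurable (U `&` `]u, t]) by apply: measurableI.
pose m (t : R) : \bar R := mu (U `&` `]u, t]).
have m_ge0 t : (0 <= m t)%E by exact: measure_ge0.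
have mle t : (m t <= e%:E)%E.
  apply: le_trans (ltW Ue); exact: mu_le.
have mfin t : m t \is a fin_num.
  by rewrite ge0_fin_numE //; apply: le_lt_trans (mle t) _; rewrite ltry.
pose psi t := fine (m t).
have psi_le t : psi t <= e by rewrite -lee_fin fineK.
have psi_ge0 t : 0 <= psi t by rewrite fine_ge0.
have psi_mono s t : s <= t -> psi s <= psi t.
  move=> st; rewrite fine_le //; apply: mu_le => //.
  apply: setIS => x; rewrite /= !in_itv /= => /andP[-> xs].
  exact: le_trans xs st.
have psi_slope s t : u <= s -> s <= t -> `]s, t] `<=` U -> t - s <= psi t - psi s.
  move=> us st stU; rewrite lerBrDr -lee_fin EFinD !fineK //.
  have -> : (t - s)%:E = mu `]s, t]%classic.
    by rewrite /mu lebesgue_measure_itv /= lte_fin; case: ltgtP st => // ->; rewrite subrr.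
  rewrite -measureU //=; last first.
    apply/seteqP; split=> // x /=; rewrite !in_itv /= => -[/andP[sx _] [_ /andP[_ xs]]].
    by have := lt_le_trans sx xs; rewrite ltxx.
  exact: mUt.
  apply: mu_le => //; first by apply: measurableU => //; exact: mUt.
  move=> x [xst|[Ux]]; rewrite /= ?in_itv /=.
    split; first exact: stU.
    by move: xst; rewrite /= in_itv /= => /andP[sx ->]; rewrite (le_lt_trans us sx).
  by move=> /andP[-> xs]; split=> //; exact: le_trans xs st.
pose Phi t := h t + e * (t - u) + K * psi t.
suff Phi_v : Phi u <= Phi v.
  rewrite mulrDr addrA [e * K]mulrC.
  have : h u <= Phi u by rewrite /Phi subrr mulr0 addr0 lerDl mulr_ge0.
  move=> /le_trans -> //; apply: le_trans Phi_v _; rewrite lerD2l.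
  exact: ler_wpM2l.
apply: contrapT => nPhi.
have [|s /andP[us sv] [As nA]] :=
    @interval_last R (fun t => Phi u <= Phi t) u v uv (lexx _) nPhi.
  move=> s /andP[us sv] adh; apply/ler_addgt0Pr => d d0.
  have Ke0 : 0 < K + e by rewrite ltr_wpDl.
  have [t /andP[st ts] [_ At]] := adh (d / (K + e)) (divr_gt0 d0 Ke0).
  apply: le_trans At _; rewrite /Phi.
  have := hK t s; rewrite ler_distl => /andP[_ hts].
  have tsn : `|t - s| = s - t by rewrite ler0_norm ?opprB // subr_le0.
  rewrite tsn in hts.
  have Kts : K * (s - t) <= d.
    have : (K + e) * (s - t) <= d.
      rewrite mulrC -ler_pdivlMr // lerBlDr -lerBlDl; exact: ltW.
    apply: le_trans; apply: ler_wpM2r; last by rewrite lerDl ltW.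
    by rewrite subr_ge0.
  have := ler_wpM2l K0 (psi_mono _ _ ts).
  have := ler_wpM2l (ltW e0) ts.
  rewrite !mulrBr in hts Kts *; lra.
suff [t /andP[st tv] Phist] : exists2 t, s < t <= v & Phi s <= Phi t.
  by apply: (nA t); rewrite ?st // (le_trans As).
have near_pt (P : R -> Prop) : (\forall t \near s, P t) ->
    exists2 t, s < t <= v & forall x, s <= x <= t -> P x.
  move=> /nbhs_ballP[d /= d0 Pd]; exists (Num.min v (s + d / 2)).
    by rewrite lt_min sv ltrDl divr_gt0 //= ge_min lexx.
  move=> x /andP[sx]; rewrite le_min => /andP[_ xd]; apply: Pd.
  rewrite /ball /= distrC ger0_norm ?subr_ge0 // ltrBlDl.
  by apply: le_lt_trans xd _; rewrite ltrD2l ltr_pdivrMr // ltr_pMr // ltr1n.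
have [sU|sU] := pselect (U s).
  have [t stv tU] := near_pt U (open_nbhs_nbhs (conj Uop sU)).
  exists t => //; case/andP: stv => st _; rewrite /Phi.
  have slope : t - s <= psi t - psi s.
    apply: psi_slope => //; first exact: ltW.
    by move=> x; rewrite /= in_itv /= => /andP[sx xt]; apply: tU; rewrite ltW.
  have := hK t s; rewrite ler_distl => /andP[hts _].
  rewrite gtr0_norm ?subr_gt0 // in hts.
  have := ler_wpM2l K0 slope.
  have := ler_wpM2l (ltW e0) (ltW st).
  rewrite !mulrBr in hts *; lra.
have [dh h'0] : derivable h s 1 /\ 0 <= 'D_1 h s.
  apply: contrapT => nds; apply/sU/NU/HN => /= hs.
  by apply: nds; apply: hs; rewrite us sv.
have [t stv tH] := near_pt _ (derivable_expansion dh e0).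
exists t => //; case/andP: stv => st _; rewrite /Phi.
have := tH t; rewrite lexx (ltW st) => /(_ isT).
rewrite ler_distl gtr0_norm ?subr_gt0 // => /andP[+ _].
have := mulr_ge0 h'0 (ltW (_ : 0 < t - s)); rewrite subr_gt0 => /(_ st).
have := ler_wpM2l K0 (psi_mono _ _ (ltW st)).
rewrite !mulrBr; lra.
Qed.

Lemma derive_sub_linear (R : realType) (g : R -> R) (c t : R) :
  derivable g t 1 -> is_derive t 1 (fun s => g s - c * s) ('D_1 g t - c).
Proof.
move=> dg; have D : is_derive t 1 g ('D_1 g t) by exact: derivableP.
have := is_deriveB D (is_deriveZ c (is_derive_id t 1)).
by rewrite [c *: 1]mulr1.
Qed.

Lemma lipschitz_ae_derive_cst (R : realType) (g : R -> R) (K c u v : R) :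
  u <= v -> (forall s t, `|g s - g t| <= K * `|s - t|) ->
  aeR (fun t => u < t < v -> derivable g t 1 /\ 'D_1 g t = c) ->
  g v - g u = c * (v - u).
Proof.
move=> uv gK gc.
pose h t := g t - c * t.
have hK s t : `|h s - h t| <= (K + `|c|) * `|s - t|.
  have -> : h s - h t = (g s - g t) - c * (s - t) by rewrite /h; ring.
  by rewrite (le_trans (ler_normB _ _)) // mulrDl lerD // normrM.
have dh (t : R) : derivable g t 1 -> 'D_1 g t = c -> is_derive t 1 h 0.
  by move=> dg gtc; have := derive_sub_linear c dg; rewrite gtc subrr.
have le1 : h u <= h v.
  apply: (lipschitz_ae_nondecreasing uv hK); apply: filterS gc => t gt tuv.
  by have [dg gtc] := gt tuv; have [? ->] := dh t dg gtc.
have le2 : - h u <= - h v.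
  apply: (@lipschitz_ae_nondecreasing R (\- h) _ _ _ uv) => [s t|].
    rewrite /= -opprD normrN; exact: hK.
  apply: filterS gc => t gt tuv.
  have [dg gtc] := gt tuv; have [dht h0] := dh t dg gtc.
  by split; [exact: derivableN|rewrite deriveN // h0 oppr0].
move: le1 le2; rewrite /h; lra.
Qed.

(** * Everywhere differentiable functions with finitely many slopes *)

(** Mean slopes over intervals containing x, with x not necessarily an endpoint,
    tend to the derivative at x. This is the form in which differentiability
    contradicts alternating mean slopes over nested intervals. *)
Lemma straddle (R : realType) (h : R -> R) (x e : R) :
  derivable h x 1 -> 0 < e ->
  exists2 r, 0 < r & forall u v, u <= x <= v -> v - u < r ->
    `|h v - h u - 'D_1 h x * (v - u)| <= e * (v - u).
Proof.
move=> dh e0; have /nbhs_ballP[r /= r0 H] := derivable_expansion dh e0.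
exists r => // u v /andP[ux xv] uvr.
have /H hu : ball x r u by rewrite /ball /= ger0_norm; lra.
have /H hv : ball x r v by rewrite /ball /= ler0_norm; lra.
move: hu hv; rewrite !ler_norml ler0_norm ?subr_le0 // ger0_norm ?subr_ge0 //.
by move=> /andP[? ?] /andP[? ?]; apply/andP; split; nra.
Qed.

Lemma derive_ge_left (R : realType) (h : R -> R) (t0 c m : R) :
  derivable h c 1 -> t0 < c ->
  (forall t, t0 < t < c -> m * (c - t) <= h c - h t) -> m <= 'D_1 h c.
Proof.
move=> dh t0c H; apply/ler_addgt0Pr => e e0.
have [r r0 S] := straddle dh e0.
pose t := Num.max ((t0 + c) / 2) (c - r / 2).
have tc : t < c by rewrite /t gt_max; apply/andP; split; lra.
have t0t : t0 < t by rewrite /t lt_max; apply/orP; left; lra.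
have tr : c - r / 2 <= t by rewrite /t le_max lexx orbT.
have := H t; rewrite t0t tc => /(_ isT) Ht.
have : t <= c <= c by rewrite lexx ltW.
move=> /S; have -> : c - t < r by lra.
move=> /(_ isT); rewrite ler_norml => /andP[_ Hr].
have ct : 0 < c - t by lra.
rewrite -(ler_pM2r ct); nra.
Qed.

(** The derivative is bounded away from 0 almost everywhere only, but exists
    everywhere; the results of this part come from the combination of the two. *)
Definition steep (R : realType) (K d a b : R) (h : R -> R) : Prop :=
  [/\ forall t, derivable h t 1, forall s t, `|h s - h t| <= K * `|s - t| &
      aeR (fun t => a < t < b -> d <= `|'D_1 h t|)].

Definition zigzag (R : realType) (h : R -> R) (u v : R) : Prop :=
  (exists s t, [/\ u < s, s < t, t < v & h s < h t]) /\
  (exists s t, [/\ u < s, s < t, t < v & h t < h s]).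

Lemma steep_opp (R : realType) (K d a b : R) (h : R -> R) :
  steep K d a b h -> steep K d a b (\- h).
Proof.
move=> [dh hK hae]; split.
- by move=> t; apply: derivableN.
- by move=> s t; rewrite /= -opprD normrN; exact: hK.
- by apply: filterS hae => t ht /ht; rewrite deriveN // normrN.
Qed.

Lemma derive_reflect (R : realType) (h : R -> R) t :
  derivable h (- t) 1 ->
  is_derive t 1 (fun t => - h (- t)) ('D_1 h (- t)).
Proof.
move=> dh.
have dh' : is_derive (- t) 1 h ('D_1 h (- t)) by exact: derivableP.
have dN : is_derive t 1 (-%R : R -> R) (- 1) by exact: is_deriveNid.
have := is_deriveN (is_derive1_comp dh' dN).
by rewrite mulrN1 opprK.
Qed.

(** The symmetry t |-> - h (- t) reverses the order of the points of the line and
    keeps the derivatives. *)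
Lemma steep_reflect (R : realType) (K d a b : R) (h : R -> R) :
  steep K d a b h -> steep K d (- b) (- a) (fun t => - h (- t)).
Proof.
move=> [dh hK hae]; split.
- by move=> t; have [] := derive_reflect (dh (- t)).
- move=> s t; rewrite -opprD normrN (le_trans (hK _ _)) //.
  by rewrite -opprD normrN.
- have N1 : (-1 : R) != 0 by rewrite oppr_eq0 oner_eq0.
  apply: filterS (aeR_comp_affine 0 N1 hae) => t; rewrite mulN1r addr0 => ht tab.
  have [_ ->] := derive_reflect (dh (- t)); apply: ht.
  by apply/andP; move/andP: tab => [? ?]; split; lra.
Qed.

(** A derivative that is everywhere above -d and a.e. outside of ]-d, d[ is a.e.
    at least d. *)
Lemma steep_nondecreasing (R : realType) (K d a b u v : R) (h : R -> R) :
  0 < d -> steep K d a b h -> a <= u -> v <= b -> u <= v ->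
  (forall t, u < t < v -> - d < 'D_1 h t) -> d * (v - u) <= h v - h u.
Proof.
move=> d0 [dh hK hae] au vb uv h'.
pose k t := h t - d * t.
have dk (t : R) : is_derive t 1 k ('D_1 h t - d) by exact: derive_sub_linear.
suff : k u <= k v by rewrite /k; lra.
apply: (@lipschitz_ae_nondecreasing R k (K + d)) => //.
  move=> s t; have -> : k s - k t = (h s - h t) - d * (s - t) by rewrite /k; ring.
  rewrite (le_trans (ler_normB _ _)) // mulrDl lerD //.
  by rewrite normrM gtr0_norm.
apply: filterS hae => t ht tuv; have [? ->] := dk t; split=> //.
have /ht : a < t < b by lra.
by have := h' t tuv; rewrite ler_normr; lra.
Qed.

Lemma steep_up_point (R : realType) (K d a b s t : R) (h : R -> R) :
  0 < d -> steep K d a b h -> a <= s -> s < t -> t <= b -> h s < h t ->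
  exists2 w, s < w < t & d <= 'D_1 h w.
Proof.
move=> d0 hst sa st tb hlt; apply: contrapT => nw.
have := steep_nondecreasing d0 (steep_opp hst) sa tb (ltW st).
have H w : s < w < t -> - d < 'D_1 (\- h) w.
  move=> stw; have [dh _ _] := hst; rewrite deriveN // ltrN2 ltNge.
  by apply/negP => dw; apply: nw; exists w.
move=> /(_ H) /=.
have := mulr_gt0 d0 (_ : 0 < t - s); rewrite subr_gt0 => /(_ st); lra.
Qed.

Lemma steep_down_point (R : realType) (K d a b s t : R) (h : R -> R) :
  0 < d -> steep K d a b h -> a <= s -> s < t -> t <= b -> h t < h s ->
  exists2 w, s < w < t & 'D_1 h w <= - d.
Proof.
move=> d0 hst sa st tb hlt.
have [|w stw] := steep_up_point d0 (steep_opp hst) sa st tb.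
  by rewrite /= ltrN2.
have [dh _ _] := hst; rewrite deriveN // => dw.
by exists w => //; rewrite lerNr.
Qed.

Definition rising_zigzag (R : realType) (h : R -> R) (d u v u' v' : R) : Prop :=
  [/\ u < u', u' < v', v' < v, v' - u' <= (v - u) / 2 & zigzag h u' v' /\
      d / 2 * (v' - u') <= h v' - h u'].

(** Follow h to the right from p, where it rises, as long as it is nondecreasing.
    This stops at a point c before q, where h falls. The derivative at c is
    at least d, by hypothesis if c = p and because the left slopes are otherwise,
    and c is in the middle of short intervals with mean slope at least d/2. On these h is not monotone: it rises
    at c, but is not nondecreasing to the right of c by the choice of c. *)
Lemma rising_zigzag_up_down (R : realType) (K d a b u v p q : R) (h : R -> R) :
  0 < d -> steep K d a b h -> a <= u -> v <= b ->
  u < p -> p < q -> q < v -> d <= 'D_1 h p -> 'D_1 h q <= - d ->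
  exists u' v', rising_zigzag h d u v u' v'.
Proof.
move=> d0 hst au vb up pq qv hp hq; have [dh hK _] := hst.
have hc x : {for x, continuous h}.
  by apply: differentiable_continuous; apply/derivable1_diffP.
pose A y := forall s t, p <= s -> s <= t -> t <= y -> h s <= h t.
have [||||c /andP[pc cq] [Ac nA]] := @interval_last R A p q.
- exact: ltW.
- by move=> s t ps st tp; have -> : s = t by lra.
- move=> Aq; have : 0 <= 'D_1 h q.
    apply: (@derive_ge_left R h p) => // t /andP[pt tq].
    by rewrite mul0r subr_ge0; apply: Aq; lra.
  lra.
- move=> y /andP[py yq] adh s t ps st ty.
  have [|yt] := ltP t y.
    move=> tly; have [|x /andP[yx xy] [px Ax]] := adh (y - t); first by lra.
    by apply: Ax => //; lra.
  have {ty yt}ty : t = y by lra.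
  rewrite ty in st *.
  have [sy|ys] := ltP s y; last by have -> : s = y by lra.
  apply/ler_addgt0Pr => e e0.
  have /nbhs_ballP[r /= r0 Hr] : \forall x \near y, `|h y - h x| <= e.
    by have /cvgrPdist_le := hc y; apply.
  have mr : 0 < Num.min r (y - s) by rewrite lt_min r0 subr_gt0.
  have [x /andP[yx xy] [px Ax]] := adh _ mr.
  have {}yx : y - x < Num.min r (y - s) by lra.
  move: yx; rewrite lt_min => /andP[yxr yxs].
  have : ball y r x by rewrite /ball /= ger0_norm // subr_ge0.
  move=> /Hr; rewrite ler_distl => /andP[+ _].
  have : h s <= h x by apply: Ax => //; lra.
  lra.
have hc' : d <= 'D_1 h c.
  have [pc'|pc'] := ltP p c; last by have -> : c = p by lra.
  apply: (@derive_ge_left R h p) => // t /andP[pt tc].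
  apply: (steep_nondecreasing d0 hst); [lra|lra|lra|].
  move=> w /andP[tw wc]; suff : 0 <= 'D_1 h w by lra.
  apply: (@derive_ge_left R h p) => //; first by lra.
  by move=> x /andP[px xw]; rewrite mul0r subr_ge0; apply: Ac; lra.
have d2 : 0 < d / 2 by lra.
have /nbhs_ballP[r /= r0 Hr] := derivable_expansion (dh c) d2.
(* The half-length e of the new interval keeps it in the range of the expansion
   at c and in ]u, v[, makes it at most half as long, and stops it before q,
   up to where the choice of c applies. *)
pose e := Num.min (r / 2) (Num.min (Num.min ((c - u) / 2) ((v - c) / 2))
  (Num.min ((v - u) / 4) (q - c))).
have e0 : 0 < e by rewrite /e !lt_min; do ?[apply/andP; split]; lra.
have [er eu ev euv eq] : [/\ e <= r / 2, e <= (c - u) / 2, e <= (v - c) / 2,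
     e <= (v - u) / 4 & e <= q - c].
  by split; rewrite /e !ge_min lexx ?orbT.
clearbody e.
have expand s : 0 < `|s - c| < r ->
    `|h s - h c - 'D_1 h c * (s - c)| <= d / 2 * `|s - c|.
  by move=> /andP[_ sr]; apply: Hr; rewrite /ball /= distrC.
have right s : c < s -> s <= c + e -> d / 2 * (s - c) <= h s - h c.
  move=> cs se; have := expand s; rewrite gtr0_norm ?subr_gt0 //.
  rewrite cs /= => H; have : s - c < r by lra.
  move=> /H; rewrite ler_norml => /andP[+ _]; nra.
have left s : s < c -> c - e <= s -> d / 2 * (c - s) <= h c - h s.
  move=> sc se; have := expand s; rewrite ltr0_norm ?subr_lt0 // opprB.
  rewrite subr_gt0 sc /= => H; have : c - s < r by lra.
  move=> /H; rewrite ler_norml => /andP[_]; nra.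
exists (c - e), (c + e); split; [lra|lra|lra|lra|split; last first].
  have := right (c + e); have := left (c - e).
  have -> : c - e < c by lra.
  have -> : c < c + e by lra.
  rewrite !lexx => /(_ isT isT) + /(_ isT isT); lra.
split.
  exists c, (c + e / 2); split; [lra|lra|lra|].
  have := right (c + e / 2); have -> : c < c + e / 2 by lra.
  have -> : c + e / 2 <= c + e by lra.
  move=> /(_ isT isT); have : 0 < d / 2 * (c + e / 2 - c).
    by apply: mulr_gt0 => //; lra.
  lra.
apply: contrapT => nz; apply: (nA (c + e / 2)); first by lra.
have up' s t : c - e < s -> s <= t -> t < c + e -> h s <= h t.
  move=> cs st tc; rewrite leNgt; apply/negP => hts; apply: nz.
  exists s, t; split=> //; rewrite lt_neqAle st andbT.
  by apply: contraTneq hts => ->; rewrite ltxx.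
move=> s t ps st te; have [tc|ct] := leP t c; first exact: Ac.
have [sc|cs] := leP s c.
  by apply: le_trans (Ac s c ps sc (lexx _)) _; apply: up'; lra.
by apply: up'; lra.
Qed.

Lemma rising_zigzag_exists (R : realType) (K d a b u v : R) (h : R -> R) :
  0 < d -> steep K d a b h -> a <= u -> v <= b -> zigzag h u v ->
  exists u' v', rising_zigzag h d u v u' v'.
Proof.
move=> d0 hst au vb [[s [t [us st tv hlt]]] [s' [t' [us' st' tv' hgt]]]].
have [||p /andP[sp pt] hp] := steep_up_point d0 hst _ st _ hlt; [lra|lra|].
have [||q /andP[sq qt] hq] := steep_down_point d0 hst _ st' _ hgt; [lra|lra|].
have [pq|qp|pq] := ltgtP p q.
- by apply: (rising_zigzag_up_down d0 hst au vb) pq _ hp hq; lra.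
(* h falls first: reflect, so that it rises first *)
- have [dh _ _] := hst; have dk x := derive_reflect (dh (- x)).
  have [|||||||u' [v' [uu' uv' vv' len [[[x [y [ux xy yv hxy]]] [x' [y' [ux' xy' yv' hxy']]]] rise]]]] :=
    @rising_zigzag_up_down R K d (- b) (- a) (- v) (- u) (- p) (- q)
      (fun x => - h (- x)) d0 (steep_reflect hst); rewrite ?lerN2 ?ltrN2 //; try lra.
  + by have [_ ->] := dk (- p); rewrite opprK.
  + by have [_ ->] := dk (- q); rewrite opprK.
  exists (- v'), (- u'); split; [lra|lra|lra|lra|split; last by lra].
  by split; [exists (- y), (- x)|exists (- y'), (- x')]; split; lra.
- by exfalso; rewrite pq in hp; lra.
Qed.

Lemma zigzag_opp (R : realType) (h : R -> R) (u v : R) :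
  zigzag h u v -> zigzag (\- h) u v.
Proof.
move=> [[s [t [us st tv hlt]]] [s' [t' [us' st' tv' hgt]]]].
by split; [exists s', t'|exists s, t]; split=> //=; rewrite ltrN2.
Qed.

(** A rising zigzag for h, followed inside of it by a rising zigzag for - h. *)
Lemma zigzag_step (R : realType) (K d a b u v : R) (h : R -> R) :
  0 < d -> steep K d a b h -> a <= u -> v <= b -> zigzag h u v ->
  exists u1 v1 u2 v2,
    [/\ [/\ u < u1, u1 <= u2, u2 < v2, v2 <= v1 & v1 < v],
        v1 - u1 <= (v - u) / 2, zigzag h u2 v2,
        d / 2 * (v1 - u1) <= h v1 - h u1 &
        h v2 - h u2 <= - (d / 2 * (v2 - u2))].
Proof.
move=> d0 hst au vb /(rising_zigzag_exists d0 hst au vb).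
move=> [u1 [v1 [uu1 uv1 vv1 len1 [z1 r1]]]].
have [||u2 [v2 [uu2 uv2 vv2 len2 [z2 r2]]]] :=
  rising_zigzag_exists d0 (steep_opp hst) _ _ (zigzag_opp z1).
- exact: le_trans au (ltW uu1).
- exact: le_trans (ltW vv1) vb.
exists u1, v1, u2, v2; split=> //; first by split=> //; exact: ltW.
  by have := zigzag_opp z2; congr zigzag; apply/funext => x /=; rewrite opprK.
by move: r2 => /=; lra.
Qed.

(** Iterating [zigzag_step] gives nested intervals that shrink to a point x and
    over which the mean slopes of h are by turns at least d/2 and at most -d/2;
    h is not differentiable at x. *)
Lemma steep_not_zigzag (R : realType) (K d a b : R) (h : R -> R) :
  0 < d -> steep K d a b h -> ~ zigzag h a b.
Proof.
move=> d0 hst zab; have [dh _ _] := hst.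
pose T := {p : R * R | [/\ a <= p.1, p.2 <= b & zigzag h p.1 p.2]}.
pose step (p q : T) := exists u1 v1,
  [/\ [/\ (sval p).1 < u1, u1 <= (sval q).1, (sval q).1 < (sval q).2,
          (sval q).2 <= v1 & v1 < (sval p).2],
      v1 - u1 <= ((sval p).2 - (sval p).1) / 2,
      d / 2 * (v1 - u1) <= h v1 - h u1 &
      h (sval q).2 - h (sval q).1 <= - (d / 2 * ((sval q).2 - (sval q).1))].
have [F FP] : {F : T -> T & forall p, step p (F p)}.
  apply: choice => -[[u v] /= [au vb zuv]].
  have [u1 [v1 [u2 [v2 [[uu1 u12 uv2 v21 v1v] len z2 r1 r2]]]]] :=
    zigzag_step d0 hst au vb zuv.
  have P2 : [/\ a <= (u2, v2).1, (u2, v2).2 <= b & zigzag h (u2, v2).1 (u2, v2).2].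
    by split=> //=; [rewrite (le_trans au) // (le_trans (ltW uu1))|
                     rewrite (le_trans _ vb) // (le_trans v21) // ltW].
  by exists (exist _ (u2, v2) P2), u1, v1.
have P0 : [/\ a <= (a, b).1, (a, b).2 <= b & zigzag h (a, b).1 (a, b).2].
  by split.
pose p n := iter n F (exist _ (a, b) P0 : T).
pose U n := (sval (p n)).1; pose V n := (sval (p n)).2.
have Umono n m : (n <= m)%N -> U n <= U m.
  apply: (@homo_leq _ U (fun x y => x <= y)) => // [y x z|i]; first exact: le_trans.
  by have [u1 [v1 [[]]]] := FP (p i); rewrite /U /=; lra.
have Vmono n m : (n <= m)%N -> V m <= V n.
  apply: (@homo_leq _ V (fun x y => y <= x)) => // [y x z ? /le_trans|i]; first exact.
  by have [u1 [v1 [[]]]] := FP (p i); rewrite /V /=; lra.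
have UV n : U n < V n.
  have [u1 [v1 [[? ? ? ? ?] _ _ _]]] := FP (p n); rewrite /U /V /=; lra.
have UVnm n m : U n <= V m.
  apply: le_trans (Umono n (maxn n m) (leq_maxl _ _)) _.
  exact: le_trans (ltW (UV _)) (Vmono _ _ (leq_maxr _ _)).
have UVlen n : V n - U n <= (b - a) / 2 ^+ n.
  elim: n => [|n IH]; first by rewrite expr0 divr1.
  have [u1 [v1 [[? ? ? ? ?] len _ _]]] := FP (p n).
  have E : (b - a) / 2 ^+ n.+1 = (b - a) / 2 ^+ n / 2.
    by rewrite exprS; field; rewrite expf_neq0.
  rewrite E /U /V /=; rewrite /U /V in IH; lra.
pose S := [set x | exists n, x = U n].
have supS : has_sup S.
  by split; [exists (U 0), 0%N|exists (V 0) => _ [n ->]].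
pose x := sup S.
have Ux n : U n <= x by apply: ub_le_sup; [case: supS|exists n].
have xV n : x <= V n.
  by apply: ge_sup; [case: supS|move=> _ [m ->]].
have d8 : 0 < d / 8 by lra.
have [r r0 Hr] := straddle (dh x) d8.
have [n nr] : exists n, V n - U n < r.
  have ab : 0 < b - a by have := UV 0%N; rewrite /U /V /= subr_gt0.
  have := @cvg_geometric R (b - a) 2^-1.
  rewrite ger0_norm ?invr_ge0 // invf_lt1 // ltr1n => /(_ isT).
  move=> /cvgrPdist_lt /(_ r r0) [n _ /(_ n (leqnn n))] /= Hn.
  exists n; apply: le_lt_trans (UVlen n) _; rewrite -exprVn.
  by apply: le_lt_trans Hn; rewrite sub0r normrN ler_norm.
have [u1 [v1 [[Uu1 u1U UVn V1 v1V] len r1 r2]]] := FP (p n).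
have Ux' : (sval (F (p n))).1 <= x := Ux n.+1.
have xV' : x <= (sval (F (p n))).2 := xV n.+1.
rewrite /U /V in nr.
have H1 := Hr u1 v1; have H2 := Hr _ _ (introT andP (conj Ux' xV')).
move: H1; have -> : u1 <= x <= v1 by lra.
have -> : v1 - u1 < r by lra.
move=> /(_ isT isT); rewrite ler_norml => /andP[_ H1].
move: H2; have -> : (sval (F (p n))).2 - (sval (F (p n))).1 < r by lra.
move=> /(_ isT); rewrite ler_norml => /andP[H2 _].
have D1 : d / 2 - d / 8 <= 'D_1 h x.
  rewrite -(ler_pM2r (_ : 0 < v1 - u1)); lra.
have D2 : 'D_1 h x <= - (d / 2) + d / 8.
  rewrite -(ler_pM2r (_ : 0 < (sval (F (p n))).2 - (sval (F (p n))).1)); lra.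
lra.
Qed.

Lemma gap_avoiding_list (R : realType) (l : seq R) (p q : R) : p < q ->
  exists p' q', [/\ p <= p', p' < q', q' <= q &
    forall s, s \in l -> s <= p' \/ q' <= s].
Proof.
move=> pq; elim: l => [|c l [p' [q' [pp pq' qq H]]]].
  by exists p, q; split.
have [cm|mc] := leP c ((p' + q') / 2).
  exists ((p' + q') / 2), q'; split; [lra|lra|lra|].
  move=> s; rewrite inE => /orP[/eqP ->|/H[sp|qs]]; [by left|left; lra|by right].
exists p', ((p' + q') / 2); split; [lra|lra|lra|].
move=> s; rewrite inE => /orP[/eqP ->|/H[sp|qs]]; [right; lra|by left|right; lra].
Qed.

(** If two mean slopes q1 < q2 of g differ, there is a number m between them
    which is at a distance d > 0 from the finitely many a.e. values of the
    derivative. Then t |-> g t - m t is steep, goes down where g has slope q1 and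
    goes up where g has slope q2, which [steep_not_zigzag] excludes. *)
Lemma affine_of_finite_derivative (R : realType) (K a b : R) (g : R -> R)
    (l : seq R) :
  (forall t, derivable g t 1) -> (forall s t, `|g s - g t| <= K * `|s - t|) ->
  a < b -> aeR (fun t => a < t < b -> 'D_1 g t \in l) ->
  exists2 s, s \in l &
    forall t u, a < t < b -> a < u < b -> g u - g t = s * (u - t).
Proof.
move=> dg gK ab gl.
have slopes (s t x y q1 q2 : R) : a < s -> s < t -> t < b ->
    a < x -> x < y -> y < b -> g t - g s = q1 * (t - s) ->
    g y - g x = q2 * (y - x) -> q1 < q2 -> False.
  move=> as_ st tb ax xy yb q1E q2E q12.
  have [p [q [q1p pq qq2 Hl]]] := gap_avoiding_list l q12.
  (* the middle and the half-length of a gap between the values of l *)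
  pose m := (p + q) / 2; pose d := (q - p) / 2.
  have d0 : 0 < d by rewrite /d; lra.
  pose h (t : R) := g t - m * t.
  have dh (t' : R) : is_derive t' 1 h ('D_1 g t' - m) by exact: derive_sub_linear.
  apply: (@steep_not_zigzag R (K + `|m|) d a b h d0).
    split.
    - by move=> t'; have [] := dh t'.
    - move=> x' y'; have -> : h x' - h y' = (g x' - g y') - m * (x' - y').
        by rewrite /h; ring.
      by rewrite (le_trans (ler_normB _ _)) // mulrDl lerD // normrM.
    - apply: filterS gl => t' Ht' tab; have [_ ->] := dh t'.
      by rewrite ler_normr /d /m; have [?|?] := Hl _ (Ht' tab); lra.
  split.
    exists x, y; split=> //; rewrite -subr_gt0.
    have -> : h y - h x = (q2 - m) * (y - x) by rewrite mulrBl -q2E /h; ring.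
    by apply: mulr_gt0; rewrite /m; lra.
  exists s, t; split=> //; rewrite -subr_gt0.
  have -> : h s - h t = (m - q1) * (t - s) by rewrite mulrBl -q1E /h; ring.
  by apply: mulr_gt0; rewrite /m; lra.
have [t0 /andP[at0 t0b] /(_ _)t0l] := aeR_ex_itv ab gl.
have {}t0l : 'D_1 g t0 \in l by apply: t0l; rewrite at0.
exists ('D_1 g t0) => //.
have slope_eq (s t : R) : a < s -> s < t -> t < b ->
    g t - g s = 'D_1 g t0 * (t - s).
  move=> as_ st tb; pose q := (g t - g s) / (t - s).
  have ts : t - s != 0 by lra.
  have qE : g t - g s = q * (t - s) by rewrite /q divfK.
  suff -> : 'D_1 g t0 = q by [].
  have all_q (x : R) : a < x < t0 -> g t0 - g x = q * (t0 - x).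
    move=> /andP[ax xt0]; have tx : t0 - x != 0 by lra.
    pose q' := (g t0 - g x) / (t0 - x).
    have q'E : g t0 - g x = q' * (t0 - x) by rewrite /q' divfK.
    rewrite q'E; congr (_ * _); apply/eqP; rewrite eq_le !leNgt.
    by apply/andP; split; apply/negP;
      [exact: (slopes s t x t0)|exact: (slopes x t0 s t)].
  apply/eqP; rewrite eq_le; apply/andP; split; last first.
    by apply: (@derive_ge_left R g a) => // x /all_q ->.
  rewrite -lerN2 -deriveN //; apply: (@derive_ge_left R (\- g) a) => //.
    exact: derivableN.
  by move=> x /all_q E /=; rewrite mulNr -E; lra.
move=> t u /andP[at_ tb] /andP[au ub]; have [tu|ut|->] := ltgtP t u.
- exact: slope_eq.
- by rewrite -opprB slope_eq // -mulrN opprB.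
- by rewrite !subrr mulr0.
Qed.

(** The pointwise infimum of the psi_j has a zero integral. *)
Lemma aeR_arbitrarily_small (R : realType) (psi : nat -> R -> \bar R) :
  (forall j, measurable_fun setT (psi j)) -> (forall j t, 0 <= psi j t)%E ->
  (forall j, \int[@lebesgue_measure R]_t psi j t <= (j.+1%:R^-1)%:E)%E ->
  aeR (fun t => forall e : R, 0 < e -> exists j, (psi j t < e%:E)%E).
Proof.
move=> mpsi psi0 Ipsi.
pose g (t : R) := einfs (psi ^~ t) 0.
have g0 t : (0 <= g t)%E by apply: le_ereal_inf_tmp => _ [j _ <-].
have mg : measurable_fun setT g by apply: measurable_fun_einfs.
have gle j t : (g t <= psi j t)%E by apply: ereal_inf_lbound; exists j.
have Ig : (\int[@lebesgue_measure R]_t `|g t| = 0)%E.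
  apply/eqP; rewrite eq_le integral_ge0 ?andbT //.
  apply/lee_addgt0Pr => e e0; rewrite add0e.
  have [j je] : exists j : nat, (j.+1%:R^-1 : R) <= e.
    have := @near_infty_natSinv_lt R (PosNum e0) => -[j _ /(_ j (leqnn j))] /= H.
    by exists j; exact: ltW.
  apply: le_trans (_ : _ <= (j.+1%:R^-1)%:E)%E _; last by rewrite lee_fin.
  apply: le_trans (Ipsi j); under eq_integral do rewrite gee0_abs //.
  apply: ge0_le_integral; [exact: measurableT|by []|exact: mg|exact: mpsi|].
  by move=> t _; exact: gle.
have [+ _] := @ae_eq_integral_abs _ _ _ (@lebesgue_measure R) setT measurableT g mg.
move=> /(_ Ig); apply: filterS => t /(_ I) gt0 e e0.
have : (g t < e%:E)%E by rewrite gt0 lte_fin.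
by move=> /ereal_inf_lt[_ [j _ <-] Hj]; exists j.
Qed.

(** * Iterated almost everywhere in several variables *)

Definition insert (R : realType) (n : nat) (k : 'I_n.+1) (t : R) (x : 'rV[R]_n) :
  'rV[R]_n.+1 := \row_i oapp (x 0) t (unlift k i).

Lemma insert_id (R : realType) n k t (x : 'rV[R]_n) : insert k t x 0 k = t.
Proof. by rewrite mxE unlift_none. Qed.

Lemma insert_lift (R : realType) n k t (x : 'rV[R]_n) i :
  insert k t x 0 (lift k i) = x 0 i.
Proof. by rewrite mxE liftK. Qed.

(** For a.e. x_0, for a.e. x_1, and so on up to x_(n-1). The outermost quantifier
    is the one on the first coordinate, but the recursion removes the last one:
    coupling layers and the induction of [affine_of_ae_affine] both treat the
    last coordinate when the others are fixed. *)
Fixpoint AE (R : realType) (n : nat) : set_system 'rV[R]_n :=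
  match n with
  | 0 => fun P => P 0
  | m.+1 => fun P => AE (fun x => aeR (fun t => P (insert ord_max t x)))
  end.

Global Instance AE_filter (R : realType) n : Filter (@AE R n).
Proof.
elim: n => [|n IH].
  by split=> //= P Q PQ; exact: PQ.
split=> /=.
- by apply: filterE => x; apply: filterE.
- by move=> P Q; apply: filterS2 => x; apply: filterS2.
- by move=> P Q PQ; apply: filterS => x; apply: filterS => t; apply: PQ.
Qed.

Lemma insert_max_ord0 (R : realType) n s t (x : 'rV[R]_n) :
  insert ord_max s (insert ord0 t x) = insert ord0 t (insert ord_max s x).
Proof.
apply/rowP => i; case: (unliftP ord0 i) => [j ->|->].
  rewrite insert_lift; case: (unliftP ord_max j) => [k ->|->].
    rewrite insert_lift; have -> : lift ord0 (lift ord_max k) = lift ord_max (lift ord0 k).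
      by apply: ord_inj; rewrite lift0 !lift_max lift0.
    by rewrite !insert_lift.
  have -> : lift ord0 ord_max = ord_max :> 'I_n.+2 by apply: ord_inj; rewrite ?lift0 ?lift_max.
  by rewrite !insert_id.
have -> : ord0 = lift ord_max ord0 :> 'I_n.+2 by apply: ord_inj; rewrite ?lift0 ?lift_max.
rewrite insert_lift insert_id.
have -> : lift ord_max ord0 = ord0 :> 'I_n.+2 by apply: ord_inj; rewrite ?lift0 ?lift_max.
by rewrite insert_id.
Qed.

(** The same quantifiers, with the first one rather than the last one apart;
    this is the form produced by slicing a cover. *)
Lemma AE_insert_ord0 (R : realType) n (P : set 'rV[R]_n.+1) :
  aeR (fun t => AE (fun x => P (insert ord0 t x))) -> AE P.
Proof.
elim: n P => [|n IH] P /=.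
  by have -> : ord_max = ord0 :> 'I_1 by exact: ord_inj.
move=> H; apply: (IH (fun x => aeR (fun t => P (insert ord_max t x)))).
apply: filterS H => t; apply: filterS => x; apply: filterS => s.
by rewrite insert_max_ord0.
Qed.

Lemma AE_dense (R : realType) n (P : set 'rV[R]_n) (x : 'rV[R]_n) (U : set 'rV[R]_n) :
  AE P -> nbhs x U -> exists2 y, U y & P y.
Proof.
move=> AP /nbhs_ballP[e /= e0 xeU].
suff [y xy Py] : exists2 y, ball x e y & P y by exists y => //; exact: xeU.
elim: n P x {U xeU} AP => [|n IH] P x /= AP.
  have -> : x = 0 by apply/rowP => -[].
  by exists 0 => //; exact: ballxx.
have [y xy] := IH _ (\row_i x 0 (lift ord_max i)) AP.
have : x 0 ord_max - e < x 0 ord_max + e by rewrite ltrD2l gtrN.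
move=> /aeR_ex_itv/[apply] -[t /andP[t1 t2] Pt]; exists (insert ord_max t y) => //.
split=> // i j; rewrite ord1; case: (unliftP ord_max j) => [k ->|->].
  by rewrite insert_lift; have := xy.2 0 k; rewrite mxE.
by rewrite insert_id /ball /= ltr_distlC t1 t2.
Qed.

(** * From box covers to iterated almost everywhere *)

(** Null sets by box covers, where moreover a set D selects the boxes that are
    used. A slice of a cover only keeps some of the boxes; and in dimension 0,
    where each box has volume 1, the empty set has to count as null for the
    induction on the dimension to start. *)
Definition null_boxes (R : realType) (n : nat) (A : set 'rV[R]_n) : Prop :=
  forall e : R, 0 < e ->
  exists (a b : nat -> 'rV[R]_n) (D : pred nat),
    [/\ forall m i, a m 0 i <= b m 0 i,
        forall x, A x -> exists2 m, D m & forall i, a m 0 i <= x 0 i <= b m 0 i &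
        (\sum_(0 <= m <oo | D m) (\prod_(i < n) (b m 0 i - a m 0 i))%:E <= e%:E)%E].

Lemma lebesgue_null_boxes (R : realType) n (A : set 'rV[R]_n) :
  lebesgue_null A -> null_boxes A.
Proof.
move=> nA e /nA[a [b [ab Aab sab]]]; exists a, b, xpredT; split=> //.
by move=> x /Aab[m _ xm]; exists m.
Qed.

Lemma null_boxes0 (R : realType) (A : set 'rV[R]_0) : null_boxes A -> ~ A 0.
Proof.
move=> /(_ (1 / 2)) []; first by lra.
move=> a [b [D [_ cov le12]]] /cov[m Dm _].
have : (1%:E <= (1 / 2 : R)%:E)%E.
  apply: le_trans le12; apply: le_trans (nneseries_lim_ge m.+1 _).
    by rewrite big_mkcond big_nat_recr //= Dm big_ord0 leeDr // sume_ge0 // => i _;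
      case: ifP => // _; rewrite big_ord0 lee_fin.
  by move=> k _ _; rewrite big_ord0 lee_fin.
by rewrite lee_fin; lra.
Qed.

(** Fubini. For the j-th cover, of total volume at most 1/(j+1), psi_j t is the
    total volume of the slices at t of its boxes; its integral is the total
    volume of the boxes, so that almost every t has covers of its slice that are
    arbitrarily small. *)
Lemma null_boxes_slice (R : realType) n (A : set 'rV[R]_n.+1) (k : 'I_n.+1) :
  null_boxes A -> aeR (fun t => null_boxes (fun x => A (insert k t x))).
Proof.
move=> nA.
have j0 (j : nat) : 0 < j.+1%:R^-1 :> R by rewrite invr_gt0.
have [a /choice[b /choice[D abD]]] := choice (fun j => nA _ (j0 j)).
pose I j m := `[a j m 0 k, b j m 0 k]%classic.
pose w j m := \prod_(i < n) (b j m 0 (lift k i) - a j m 0 (lift k i)).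
have w0 j m : 0 <= w j m.
  by apply: prodr_ge0 => i _; rewrite subr_ge0; have [+ _ _] := abD j; apply.
pose c j m : R := if D j m then w j m else 0.
have c0 j m : 0 <= c j m by rewrite /c; case: ifP.
pose psi j t : \bar R := (\sum_(m <oo) ((c j m)%:E * (\1_(I j m) t)%:E))%E.
have mI j m : measurable (I j m) by exact: measurable_itv.
have mterm j m : measurable_fun setT (fun t => (c j m)%:E * (\1_(I j m) t)%:E)%E.
  by apply: measurable_funeM; apply/measurable_EFinP; exact: measurable_indic.
have term0 j m t : (0 <= (c j m)%:E * (\1_(I j m) t)%:E)%E.
  by rewrite mule_ge0 // lee_fin.
apply: filterS (aeR_arbitrarily_small (psi := psi) _ _ _).
- move=> t small e /small[j je].
  exists (fun m => \row_i a j m 0 (lift k i)), (fun m => \row_i b j m 0 (lift k i)),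
    (fun m => D j m && (a j m 0 k <= t <= b j m 0 k)); split.
  + by move=> m i; rewrite !mxE; have [+ _ _] := abD j; apply.
  + move=> x Ax; have [_ cov _] := abD j; have [m Dm xm] := cov _ Ax.
    exists m; first by rewrite Dm; have := xm k; rewrite insert_id.
    by move=> i; rewrite !mxE; have := xm (lift k i); rewrite insert_lift.
  + apply: le_trans (ltW je); rewrite eseries_mkcond /psi.
    apply: lee_nneseries => [m _ _|m _].
      by case: ifP => // _; rewrite lee_fin prodr_ge0 // => i _;
         rewrite !mxE subr_ge0; have [+ _ _] := abD j; apply.
    rewrite /c indicE /I mem_setE in_itv /=.
    case: (D j m) => /=; last by rewrite mul0e.
    case: (_ <= _ <= _); last by rewrite mule0.
    by rewrite mule1 lee_fin /w; under eq_bigr do rewrite !mxE.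
- move=> j; apply: ge0_emeasurable_sum => //.
- by move=> j t; apply: nneseries_ge0.
- move=> j; rewrite integral_nneseries //; last exact: mterm.
  have [ab _] := abD j; apply: le_trans; rewrite [leRHS]eseries_mkcond.
  apply: lee_nneseries => [m _ _|m _]; first exact: integral_ge0.
  rewrite ge0_integralZl_EFin //; last first.
    by apply/measurable_EFinP; apply: measurable_indic; exact: mI.
  have Imu : (\int[@lebesgue_measure R]_t (\1_(I j m) t)%:E = lebesgue_measure (I j m))%E.
    by rewrite integral_indic ?setIT //; exact: mI.
  rewrite [X in (_ * X)%E]Imu /I lebesgue_measure_itv /= lte_fin /c.
  case: (D j m); last by rewrite mul0e.
  rewrite (bigD1_ord k) //= mulrC EFinM /w; apply: lee_wpmul2l.
    by rewrite lee_fin; exact: w0.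
  by case: ifP => // _; rewrite lee_fin subr_ge0.
Qed.

Lemma lebesgue_null_AE (R : realType) n (A : set 'rV[R]_n) :
  lebesgue_null A -> AE (~` A).
Proof.
move/lebesgue_null_boxes; elim: n A => [|n IH] A nA; first exact: null_boxes0.
apply: AE_insert_ord0; apply: filterS (null_boxes_slice ord0 nA) => t.
exact: IH.
Qed.

Lemma lebesgue_null_perm (R : realType) n (s : 'S_n) (A : set 'rV[R]_n) :
  lebesgue_null A -> lebesgue_null (fun x => A (col_perm s x)).
Proof.
move=> nA e /nA[a [b [ab Aab sab]]].
exists (fun m => col_perm s^-1%g (a m)), (fun m => col_perm s^-1%g (b m)); split.
- by move=> m i; rewrite !mxE.
- move=> x /Aab[m _ xm]; exists m => // i; rewrite !mxE.
  by have := xm (s^-1 i)%g; rewrite mxE permKV.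
- apply: le_trans sab; apply: lee_nneseries => [m _ _|m _].
    by rewrite lee_fin prodr_ge0 // => i _; rewrite !mxE subr_ge0.
  rewrite lee_fin [leRHS](reindex_perm s^-1%g) /=.
  by under eq_bigr do rewrite !mxE.
Qed.

(** For a direction r other than the last one, exchange coordinates first. *)
Lemma lebesgue_null_AE_line (R : realType) n (A : set 'rV[R]_n.+1) (r : 'I_n.+1) :
  lebesgue_null A ->
  AE (fun x : 'rV_n => aeR (fun t => ~ A (insert r t x))).
Proof.
move=> /(lebesgue_null_perm (lift_perm r ord_max 1)) /lebesgue_null_AE /=.
apply: filterS => x; apply: filterS => t /=.
suff -> : col_perm (lift_perm r ord_max 1) (insert ord_max t x) = insert r t x.
  by [].
apply/rowP => i; rewrite mxE; case: (unliftP r i) => [j ->|->].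
  by rewrite lift_perm_lift perm1 !insert_lift.
by rewrite lift_perm_id !insert_id.
Qed.

(** * Functions that are locally affine almost everywhere *)

Lemma rV_entry_le (R : realType) n (x : 'rV[R]_n) i : `|x 0 i| <= `|x|.
Proof.
by rewrite -[`|x|]/(mx_norm x) mx_normrE; apply: (le_bigmax _ _ (0, i)).
Qed.

Lemma rV_norm_le (R : realType) n (x : 'rV[R]_n) (c : R) :
  0 <= c -> (forall i, `|x 0 i| <= c) -> `|x| <= c.
Proof.
move=> c0 H; rewrite -[`|x|]/(mx_norm x) mx_normrE; apply/bigmax_leP; split=> //.
by case=> i j _ /=; rewrite ord1.
Qed.

Lemma insert_shift (R : realType) n (k : 'I_n.+1) (t h : R) (x : 'rV[R]_n) :
  insert k (h + t) x = h *: delta_mx 0 k + insert k t x.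
Proof.
apply/rowP => i; case: (unliftP k i) => [j ->|->]; rewrite !mxE.
  by rewrite liftK /= ?eqxx [lift k j == k]eq_sym (negbTE (neq_lift _ _)) ?andbF mulr0 add0r.
by rewrite unlift_none /= !eqxx mulr1.
Qed.

Lemma insert_surj (R : realType) n (k : 'I_n.+1) (y : 'rV[R]_n.+1) :
  y = insert k (y 0 k) (\row_i y 0 (lift k i)).
Proof.
apply/rowP => i; case: (unliftP k i) => [j ->|->].
  by rewrite insert_lift mxE.
by rewrite insert_id.
Qed.

Lemma insert_dist (R : realType) n (k : 'I_n.+1) (t u : R) (x y : 'rV[R]_n) :
  `|insert k t x - insert k u y| <= Num.max `|t - u| `|x - y|.
Proof.
apply: rV_norm_le; first by rewrite le_max normr_ge0.
move=> i; rewrite !mxE; case: (unliftP k i) => [j _|_] /=.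
  rewrite le_max; apply/orP; right.
  by have := rV_entry_le (x - y) j; rewrite !mxE.
by rewrite le_max lexx.
Qed.

Lemma insert_dist_l (R : realType) n (k : 'I_n.+1) (t u : R) (x : 'rV[R]_n) :
  `|insert k t x - insert k u x| <= `|t - u|.
Proof.
apply: le_trans (insert_dist _ _ _ _ _) _.
by rewrite subrr normr0 ge_max lexx normr_ge0.
Qed.

Lemma insert_dist_r (R : realType) n (k : 'I_n.+1) (t : R) (x y : 'rV[R]_n) :
  `|insert k t x - insert k t y| <= `|x - y|.
Proof.
apply: le_trans (insert_dist _ _ _ _ _) _.
by rewrite subrr normr0 ge_max lexx normr_ge0.
Qed.

Lemma near_insert (R : realType) n (k : 'I_n.+1) (t : R) (x : 'rV[R]_n) U :
  nbhs (insert k t x) U -> exists2 e, 0 < e & forall u y,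
    `|t - u| < e -> `|x - y| < e -> U (insert k u y).
Proof.
case/nbhs_normP => e /= e0 H; exists e => // u y tu xy; apply: H => /=.
by apply: le_lt_trans (insert_dist _ _ _ _ _) _; rewrite gt_max tu xy.
Qed.

Lemma mulmx_insert (R : realType) n (k : 'I_n.+1) (t : R) (x : 'rV[R]_n)
    (a : 'cV[R]_n.+1) :
  (insert k t x *m a) 0 0 =
  t * a k 0 + (x *m (\col_i a (lift k i) 0)) 0 0.
Proof.
rewrite !mxE (bigD1_ord k) //= insert_id; congr (_ + _).
by apply: eq_bigr => i _; rewrite insert_lift mxE.
Qed.

Lemma mulmxBE (R : realType) n (u v : 'rV[R]_n) (a : 'cV[R]_n) :
  ((u - v) *m a) 0 0 = (u *m a) 0 0 - (v *m a) 0 0.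
Proof. by rewrite mulmxBl mxE [X in _ + X]mxE. Qed.

Lemma insert_quotient (R : realType) n (f : 'rV[R]_n.+1 -> R) k t x :
  (fun h : R => h^-1 *: (f (insert k (h *: 1 + t) x) - f (insert k t x))) =
  (fun h : R => h^-1 *: (f (h *: delta_mx 0 k + insert k t x) - f (insert k t x))).
Proof. by apply/funext => h; rewrite insert_shift [h *: 1]mulr1. Qed.

Lemma derivable_insert (R : realType) n (f : 'rV[R]_n.+1 -> R) k t x :
  derivable (fun u => f (insert k u x)) t 1 =
  derivable f (insert k t x) (delta_mx 0 k).
Proof. by rewrite /derivable insert_quotient. Qed.

Lemma derive_insert (R : realType) n (f : 'rV[R]_n.+1 -> R) k t x :
  'D_1 (fun u => f (insert k u x)) t = 'D_(delta_mx 0 k) f (insert k t x).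
Proof. by rewrite /derive insert_quotient. Qed.

Definition locally_affine (R : realType) n (f : 'rV[R]_n -> R) (x : 'rV[R]_n)
    (a : 'cV[R]_n) : Prop :=
  \forall y \near x, f y = f x + ((y - x) *m a) 0 0.

(** The entries of the slopes, not the slopes, are in a finite list: this is
    equivalent and avoids lists of vectors of various sizes. The list depends on
    x0 because the pieces are locally finite only. *)
Definition ae_affine (R : realType) n (f : 'rV[R]_n -> R) : Prop :=
  exists2 W : set 'rV[R]_n, AE W &
    forall x0 : 'rV[R]_n, exists l : seq R, \forall x \near x0, W x ->
      exists2 a : 'cV[R]_n, (forall i, a i 0 \in l) & locally_affine f x a.

Lemma near_affine_derive (R : realType) (g : R -> R) (t s : R) :
  (\forall u \near t, g u - g t = s * (u - t)) -> is_derive t 1 g s.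
Proof.
move=> H.
have D : is_derive t 1 (cst (g t - s * t) + s \*: id) (0 + s *: 1).
  by apply: is_deriveD.
rewrite add0r [s *: 1]mulr1 in D.
apply: near_eq_is_derive D.
apply: filterS H => u E; transitivity (g t - s * t + s * u) => //; lra.
Qed.

Lemma locally_affine_derive (R : realType) n (f : 'rV[R]_n.+1 -> R) k t x a :
  locally_affine f (insert k t x) a ->
  'D_1 (fun u => f (insert k u x)) t = a k 0.
Proof.
move=> /near_insert[e e0 H].
suff : is_derive t 1 (fun u => f (insert k u x)) (a k 0) by case.
apply: near_affine_derive; apply/nbhs_normP; exists e => //= u tu.
rewrite (H u x) ?subrr ?normr0 // [_ + _ - _]addrC addKr mulmxBE.
by rewrite !mulmx_insert; ring.
Qed.

Lemma locally_constant_cst (R : realType) (g : R -> R) :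
  (forall t, \forall u \near t, g u = g t) -> forall t u, g t = g u.
Proof.
move=> H t u; apply: is_derive_0_is_cst => {u}u.
by apply: near_affine_derive; apply: filterS (H u) => x ->; rewrite subrr mul0r.
Qed.

Lemma isolated_in_list (R : realType) (l : seq R) (c : R) :
  exists2 e, 0 < e & forall s, s \in l -> `|s - c| < e -> s = c.
Proof.
elim: l => [|b l [e e0 H]]; first by exists 1.
have [->|bc] := eqVneq b c.
  by exists e => // s; rewrite inE => /orP[/eqP|/H].
(* below |b - c|, the new element b cannot be confused with c *)
exists (Num.min e `|b - c|); first by rewrite lt_min e0 normr_gt0 subr_eq0.
move=> s; rewrite inE lt_min => /orP[/eqP -> /andP[_]|/H{}H /andP[/H]] //.
by rewrite ltxx.
Qed.

(** * Differentiable almost-everywhere-affine functions are affine *)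

Lemma lipschitz_ge0 (R : realType) n (f : 'rV[R]_n.+1 -> R) (K : R) :
  (forall x y, `|f x - f y| <= K * `|x - y|) -> 0 <= K.
Proof.
move=> /(_ (delta_mx 0 ord0) 0); rewrite subr0 => H.
have d0 : 0 < `|delta_mx 0 ord0 : 'rV[R]_n.+1|.
  rewrite normr_gt0; apply/eqP => /rowP/(_ ord0)/eqP.
  by rewrite !mxE !eqxx oner_eq0.
by rewrite -(pmulr_lge0 _ d0); apply: le_trans H.
Qed.

(** An increment that is the same on almost every line is the same on all lines,
    by density and continuity. *)
Lemma AE_line_increment (R : realType) n (f : 'rV[R]_n.+1 -> R) (K : R)
    (Q : set 'rV[R]_n) (k : 'I_n.+1) (x0 x : 'rV[R]_n) (e t u v : R) :
  (forall x y, `|f x - f y| <= K * `|x - y|) -> AE Q -> `|x0 - x| < e ->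
  (forall y, Q y -> `|x0 - y| < e -> f (insert k u y) - f (insert k t y) = v) ->
  f (insert k u x) - f (insert k t x) = v.
Proof.
move=> fK AQ xe H; have K0 := lipschitz_ge0 fK.
have K1 : 0 < 2 * K + 1 by lra.
apply/eqP; rewrite -subr_eq0 -normr_le0; apply/ler_addgt0Pr => z z0; rewrite add0r.
have U1 : \forall y \near x, `|x0 - y| < e /\ `|x - y| < z / (2 * K + 1).
  have N1 : \forall y \near x, `|x0 - y| < e.
    apply/nbhs_normP; exists (e - `|x0 - x|); first by rewrite /= subr_gt0.
    move=> y /= xy; rewrite -(subrKA x) (le_lt_trans (ler_normD _ _)) //.
    by rewrite -ltrBrDl.
  have N2 : \forall y \near x, `|x - y| < z / (2 * K + 1).
    by apply/nbhs_normP; exists (z / (2 * K + 1)); [exact: divr_gt0|].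
  exact: (filterI N1 N2).
have [y [y1 yz] Qy] := AE_dense AQ U1.
rewrite ltr_pdivlMr // in yz; rewrite -(H y Qy y1).
have -> (p q r s : R) : p - q - (r - s) = (p - r) - (q - s) by ring.
apply: le_trans (ler_normB _ _) _.
have gx w : `|f (insert k w x) - f (insert k w y)| <= K * `|x - y|.
  by apply: le_trans (fK _ _) _; apply: ler_wpM2l => //; exact: insert_dist_r.
have := gx u; have := gx t; have := normr_ge0 (x - y); nra.
Qed.

(** Near x0, f is affine on almost every line in the last direction, with a slope
    in the list l. The slope is read off two values of f by sigma, which is
    continuous, and the elements of l are isolated: close to x0 the slope is
    sigma x0. *)
Lemma ae_affine_slope (R : realType) n (f : 'rV[R]_n.+1 -> R) (K : R)
    (t0 : R) (x0 : 'rV[R]_n) :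
  (forall x r, derivable f x (delta_mx 0 r)) ->
  (forall x y, `|f x - f y| <= K * `|x - y|) -> ae_affine f ->
  exists s e, 0 < e /\ forall x t u, `|x0 - x| < e -> `|t0 - t| < e ->
    `|t0 - u| < e ->
    f (insert ord_max u x) - f (insert ord_max t x) = s * (u - t).
Proof.
move=> df fK [W AW Wl].
have K0 := lipschitz_ge0 fK.
have [l] := Wl (insert ord_max t0 x0).
case/near_insert => e e0 We.
pose g x t := f (insert ord_max t x).
have gK x s t : `|g x s - g x t| <= K * `|s - t|.
  by apply: le_trans (fK _ _) _; apply: ler_wpM2l => //; exact: insert_dist_l.
have gx x y t : `|g x t - g y t| <= K * `|x - y|.
  by apply: le_trans (fK _ _) _; apply: ler_wpM2l => //; exact: insert_dist_r.
have dg x t : derivable (g x) t 1 by rewrite derivable_insert.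
pose Q := fun x => aeR (fun t => W (insert ord_max t x)).
have good x : Q x -> `|x0 - x| < e -> exists2 s, s \in l &
    forall t u, t0 - e < t < t0 + e -> t0 - e < u < t0 + e ->
      g x u - g x t = s * (u - t).
  move=> Qx xe; apply: (affine_of_finite_derivative (K := K)) => //; first by lra.
  apply: filterS Qx => t Wt tt0.
  have [|a al fa] := We t x _ xe Wt; first by rewrite ltr_distlC.
  by rewrite (locally_affine_derive fa).
pose sigma x := (g x (t0 + e / 2) - g x t0) / (e / 2).
have [d d0 Hd] := isolated_in_list l (sigma x0).
(* sigma has Lipschitz constant 2 K / (e / 2); the + 1 only avoids a zero
   denominator *)
pose e1 := Num.min e (d * (e / 2) / (2 * K + 1)).
have K1 : 0 < 2 * K + 1 by lra.
have e1_gt0 : 0 < e1.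
  by rewrite lt_min e0 divr_gt0 // mulr_gt0 // divr_gt0.
have e1e : e1 <= e by rewrite ge_min lexx.
have sigma_near x : `|x0 - x| < e1 -> `|sigma x - sigma x0| < d.
  rewrite lt_min => /andP[_]; rewrite ltr_pdivlMr // => xe.
  have e2 : 0 < e / 2 by lra.
  have -> : sigma x - sigma x0 =
      ((g x (t0 + e / 2) - g x0 (t0 + e / 2)) - (g x t0 - g x0 t0)) / (e / 2).
    by rewrite /sigma -mulrBl; congr (_ / _); ring.
  rewrite normrM normfV (gtr0_norm e2) ltr_pdivrMr //.
  apply: le_lt_trans xe; apply: le_trans (ler_normB _ _) _.
  have := gx x x0 (t0 + e / 2); have := gx x x0 t0; rewrite (distrC x x0).
  have := normr_ge0 (x0 - x); nra.
exists (sigma x0), e1; split=> // x t u xe te ue.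
have teb : t0 - e < t < t0 + e by rewrite -ltr_distlC (lt_le_trans te).
have ueb : t0 - e < u < t0 + e by rewrite -ltr_distlC (lt_le_trans ue).
have good' y : Q y -> `|x0 - y| < e1 -> g y u - g y t = sigma x0 * (u - t).
  move=> Qy ye; have [s sl Hs] := good y Qy (lt_le_trans ye e1e).
  rewrite Hs //; congr (_ * _); apply: Hd => //.
  have -> : s = sigma y; last exact: sigma_near.
  rewrite /sigma Hs; [|lra|lra].
  by field; lra.
have AQ : AE Q by exact: AW.
exact: (AE_line_increment fK AQ xe).
Qed.

(** By [ae_affine_slope] the last partial derivative is locally constant, hence
    constant. *)
Lemma ae_affine_split (R : realType) n (f : 'rV[R]_n.+1 -> R) (K : R) :
  (forall x r, derivable f x (delta_mx 0 r)) ->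
  (forall x y, `|f x - f y| <= K * `|x - y|) -> ae_affine f ->
  exists s, forall x t, f (insert ord_max t x) = f (insert ord_max 0 x) + s * t.
Proof.
move=> df fK faff.
pose D p := 'D_(delta_mx 0 ord_max) f p.
have lc p : \forall q \near p, D q = D p.
  have [s [e [e0 He]]] := ae_affine_slope (p 0 ord_max)
    (\row_i p 0 (lift ord_max i)) df fK faff.
  have Ds t x : `|(\row_i p 0 (lift ord_max i)) - x| < e ->
      `|p 0 ord_max - t| < e -> D (insert ord_max t x) = s.
    move=> xe te; rewrite /D -derive_insert.
    suff : is_derive t 1 (fun u => f (insert ord_max u x)) s by case.
    apply: near_affine_derive; apply/nbhs_normP.
    exists (e - `|p 0 ord_max - t|); first by rewrite /= subr_gt0.
    move=> u /= tu; apply: He => //.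
    rewrite -(subrKA t) (le_lt_trans (ler_normD _ _)) //.
    by rewrite -ltrBrDl.
  have Dp : D p = s.
    by rewrite (insert_surj ord_max p) Ds // subrr normr0.
  rewrite Dp; apply/nbhs_normP; exists e => // q /= pq.
  rewrite (insert_surj ord_max q) Ds //.
    apply: le_lt_trans pq; apply: rV_norm_le => // i; rewrite !mxE.
    by have := rV_entry_le (p - q) (lift ord_max i); rewrite !mxE.
  by apply: le_lt_trans pq; have := rV_entry_le (p - q) ord_max; rewrite !mxE.
have Dcst p q : D p = D q.
  pose phi t := D (p + t *: (q - p)).
  suff : phi 0 = phi 1 by rewrite /phi scale0r addr0 scale1r addrC subrK.
  apply: locally_constant_cst => t.
  have /nbhs_normP[e /= e0 He] := lc (p + t *: (q - p)).
  have d0 : 0 < `|q - p| + 1 by rewrite ltr_wpDl.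
  apply/nbhs_normP; exists (e / (`|q - p| + 1)); first exact: divr_gt0.
  move=> u /=; rewrite ltr_pdivlMr // => tu; apply: He => /=.
  rewrite opprD addrACA subrr add0r -scalerBl normrZ (le_lt_trans _ tu) //.
  by apply: ler_wpM2l => //; rewrite lerDl.
exists (D 0) => x t; apply/eqP; rewrite -subr_eq; apply/eqP.
transitivity (f (insert ord_max 0 x) - D 0 * 0); last by rewrite mulr0 subr0.
apply: (@is_derive_0_is_cst R (fun t => f (insert ord_max t x) - D 0 * t)) => u.
have D1 : is_derive u 1 (fun t => f (insert ord_max t x)) (D 0).
  rewrite -(Dcst (insert ord_max u x)) /D -derive_insert.
  by apply: derivableP; rewrite derivable_insert.
have := is_deriveB D1 (is_deriveZ (D 0) (is_derive_id u 1)).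
by rewrite [D 0 *: 1]mulr1 subrr.
Qed.

(** By [ae_affine_split], f is the sum of a linear function of the last coordinate
    and of its restriction to the hyperplane where this coordinate is 0. The
    restriction inherits the hypotheses: nearby hyperplanes meet the set of good
    points, and f is there the same function up to a constant. *)
Lemma affine_of_ae_affine (R : realType) n (f : 'rV[R]_n -> R) (K : R) :
  (forall x r, derivable f x (delta_mx 0 r)) ->
  (forall x y, `|f x - f y| <= K * `|x - y|) -> ae_affine f ->
  exists (a : 'cV[R]_n) (b : R), forall x, f x = (x *m a) 0 0 + b.
Proof.
elim: n f => [|n IH] f df fK faff.
  exists 0, (f 0) => x; rewrite mulmx0 mxE add0r; congr f.
  by apply/rowP => -[].
have [s fs] := ae_affine_split df fK faff.
pose h x := f (insert ord_max 0 x).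
have dh x r : derivable h x (delta_mx 0 r).
  have E : (fun z : R => z^-1 *: (h (z *: delta_mx 0 r + x) - h x)) =
      (fun z : R => z^-1 *: (f (z *: delta_mx 0 (lift ord_max r) +
        insert ord_max 0 x) - f (insert ord_max 0 x))).
    apply/funext => z; congr (_ *: (f _ - _)).
    apply/rowP => i; case: (unliftP ord_max i) => [j ->|->]; rewrite !mxE.
      by rewrite liftK /= !mxE (inj_eq lift_inj).
    by rewrite unlift_none /= (negbTE (neq_lift _ _)) ?andbF mulr0 addr0.
  rewrite /derivable E; exact: df.
have hK x y : `|h x - h y| <= K * `|x - y|.
  have K0 := lipschitz_ge0 fK.
  apply: le_trans (fK _ _) _; apply: ler_wpM2l => //; exact: insert_dist_r.
have haff : ae_affine h.
  have [W AW Wl] := faff.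
  exists (fun x => forall e, 0 < e -> exists2 t, `|t| < e & W (insert ord_max t x)).
    have AQ : AE (fun x => aeR (fun t => W (insert ord_max t x))) by exact: AW.
    apply: filterS AQ => x Wx e e0.
    have ee : - e < e by lra.
    by have [t te Wt] := aeR_ex_itv ee Wx; exists t => //; rewrite ltr_norml.
  move=> x0; have [l] := Wl (insert ord_max 0 x0).
  case/near_insert => e e0 We; exists l; apply/nbhs_normP; exists e => // x /= xe.
  move=> /(_ e e0)[t te Wt].
  have [|a al fa] := We t x _ xe Wt; first by rewrite sub0r normrN.
  exists (\col_i a (lift ord_max i) 0); first by move=> i; rewrite mxE.
  have [d d0 Hd] := near_insert fa.
  apply/nbhs_normP; exists d => // y /= xy.
  have := Hd t y; rewrite subrr normr0 => /(_ d0 xy).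
  by rewrite !(fs _ t) -/(h y) -/(h x) !mulmxBE !mulmx_insert; lra.
have [a [b hab]] := IH h dh hK haff.
exists (\col_i oapp (a ^~ 0) s (unlift ord_max i)), b => x.
rewrite {1}(insert_surj ord_max x) fs -/(h _) hab {3}(insert_surj ord_max x).
rewrite mulmx_insert mxE unlift_none /= mulrC addrAC; congr (_ + _).
rewrite addrC; congr (_ + _); rewrite !mxE; apply: eq_bigr => i _.
by rewrite !mxE liftK.
Qed.

(** * Composition *)

Lemma matrices_over_list (R : realType) (l : seq R) (m n : nat) :
  exists L : seq 'M[R]_(m, n), forall A : 'M[R]_(m, n),
    (forall i j, A i j \in l) -> A \in L.
Proof.
exists [seq \matrix_(i, j) l`_(g (i, j)) | g : {ffun 'I_m * 'I_n -> 'I_(size l)}].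
move=> A Al.
have idx (p : 'I_m * 'I_n) : (index (A p.1 p.2) l < size l)%N by rewrite index_mem.
apply/mapP; exists [ffun p => Ordinal (idx p)]; first by rewrite mem_enum.
by apply/matrixP => i j; rewrite mxE ffunE /= nth_index.
Qed.

(** Chain rule. The entries of a product of a slope of G and a slope of f belong
    to a finite list because there are finitely many matrices with entries in a
    finite list. *)
Lemma ae_affine_comp (R : realType) n m (f : 'rV[R]_m -> R)
    (G : 'rV[R]_n -> 'rV[R]_m) :
  ae_affine f -> continuous G ->
  (forall P, AE P -> AE (fun x => P (G x))) ->
  (forall j, ae_affine (fun x => G x 0 j)) -> ae_affine (fun x => f (G x)).
Proof.
move=> [W AW Wl] Gc GAE Gaff.
have Gaff' j : exists Wj : set 'rV[R]_n, AE Wj /\ forall x0 : 'rV[R]_n,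
    exists l : seq R, \forall x \near x0, Wj x -> exists2 a : 'cV[R]_n,
      (forall i, a i 0 \in l) & locally_affine (fun x => G x 0 j) x a.
  by have [Wj ? ?] := Gaff j; exists Wj.
have [V VP] := choice Gaff'.
exists (fun x => (forall j, V j x) /\ W (G x)).
  apply: filterI; last exact: GAE.
  by apply: filter_forall => j; have [] := VP j.
move=> x0; have [l lP] := choice (fun j => (VP j).2 x0).
have [k kP] := Wl (G x0).
have [L LP] := matrices_over_list (flatten [seq l j | j : 'I_m]) n m.
have [M MP] := matrices_over_list k m 1.
exists [seq (p.1 *m p.2.1) p.2.2 0 | p <- allpairs pair L (allpairs pair M (enum 'I_n))].
have Vnear : \forall x \near x0, forall j, V j x -> exists2 a : 'cV[R]_n,
    (forall i, a i 0 \in l j) & locally_affine (fun x => G x 0 j) x a.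
  by apply: (filter_forall (nbhs_filter x0)) => j; exact: lP.
have Wnear := Gc x0 _ kP.
apply: filterS2 Vnear Wnear => x Vx Wx [Vx' Wx'].
have [b bk fb] := Wx Wx'.
have /choice[a aP] : forall j, exists a : 'cV[R]_n,
   (forall i, a i 0 \in l j) /\ locally_affine (fun x => G x 0 j) x a.
  by move=> j; have [a ? ?] := Vx j (Vx' j); exists a.
pose A := \matrix_(i, j) a j i 0.
exists (A *m b).
  move=> i; apply/mapP; exists (A, (b, i)) => //; apply: allpairs_f.
    apply: LP => i' j; apply/flattenP; exists (l j); last first.
      by rewrite mxE; have [+ _] := aP j; apply.
    by apply: map_f; rewrite mem_enum.
  apply: allpairs_f; last by rewrite mem_enum.
  by apply: MP => i' j; rewrite ord1.
have aff : \forall y \near x, forall j, G y 0 j = G x 0 j + ((y - x) *m a j) 0 0.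
  by apply: (filter_forall (nbhs_filter x)) => j; have [] := aP j.
apply: filterS2 aff (Gc x _ fb) => y affy ->.
congr (_ + _); rewrite mulmxA; congr ((_ *m b) 0 0).
apply/rowP => j; rewrite !mxE affy addrC addKr !mxE.
by apply: eq_bigr => i _; rewrite !mxE.
Qed.

Lemma ae_affine_add_coord (R : realType) n (f : 'rV[R]_n -> R) (c : R) (j : 'I_n) :
  ae_affine f -> ae_affine (fun x => c * x 0 j + f x).
Proof.
move=> [W AW Wl]; exists W => // x0; have [l lP] := Wl x0.
exists (l ++ [seq c + s | s <- l]); apply: filterS lP => x lx /lx[a al fa].
exists (c *: delta_mx j 0 + a).
  move=> i; rewrite !mxE mem_cat eqxx andbT; have [_|_] := eqVneq i j.
    by rewrite mulr1 map_f ?orbT.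
  by rewrite mulr0 add0r al.
apply: filterS fa => y ->; rewrite mulmxDr -scalemxAr -colE !mxE; ring.
Qed.

Lemma ae_affine_coord (R : realType) n (j : 'I_n) :
  ae_affine (fun x : 'rV[R]_n => x 0 j).
Proof.
exists setT; first exact: filterT.
move=> x0; exists [:: 0; 1]; apply: filterE => x _.
exists (delta_mx j 0).
  by move=> i; rewrite mxE eqxx andbT; case: (i == j); rewrite !inE eqxx ?orbT.
by apply: filterE => y; rewrite -colE !mxE [RHS]addrC subrK.
Qed.

(** * Coupling layers *)

Lemma lipschitz_exists (R : realType) n (f : 'rV[R]_n -> R) :
  lipschitz f -> exists2 K, 0 <= K & forall x y, `|f x - f y| <= K * `|x - y|.
Proof.
move=> [M [_ HM]]; exists (Num.max 0 (M + 1)); first by rewrite le_max lexx.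
move=> x y; apply: (HM (Num.max 0 (M + 1)) _ (x, y)) => //.
by rewrite lt_max ltrDl ltr01 orbT.
Qed.

Lemma before_dist (R : realType) n (j : 'I_n) (x y : 'rV[R]_n) :
  `|before j x - before j y| <= `|x - y|.
Proof.
apply: rV_norm_le => // i; rewrite !mxE.
by have := rV_entry_le (x - y) (widen_ord (ltnW (ltn_ord j)) i); rewrite !mxE.
Qed.

Lemma insert_widen (R : realType) n t (x : 'rV[R]_n) (j : 'I_n) (le : (n <= n.+1)%N) :
  insert ord_max t x 0 (widen_ord le j) = x 0 j.
Proof.
have -> : widen_ord le j = lift ord_max j by apply: ord_inj; rewrite lift_max.
by rewrite insert_lift.
Qed.

Lemma before_ord_max (R : realType) n t (x : 'rV[R]_n) :
  before ord_max (insert ord_max t x) = x.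
Proof.
apply/rowP => i; rewrite mxE.
by rewrite (_ : widen_ord _ i = widen_ord (leqnSn n) i) ?insert_widen //; apply: ord_inj.
Qed.

Lemma before_widen (R : realType) n t (x : 'rV[R]_n) (j : 'I_n) :
  before (widen_ord (leqnSn n) j) (insert ord_max t x) = before j x.
Proof.
apply/rowP => i; rewrite [LHS]mxE [RHS]mxE.
rewrite -(insert_widen t x _ (leqnSn n)); congr (_ 0 _).
exact: ord_inj.
Qed.

Lemma AE_before (R : realType) n (j : 'I_n) (P : set 'rV[R]_j) :
  AE P -> AE (fun x => P (before j x)).
Proof.
case: j P => j /= jn P AP.
elim: n jn => // n IH jn /=.
have [jn'|nj] := ltnP j n.
  have := IH jn'; apply: filterS => x Px; apply: filterE => t.
  congr (P _): Px; apply/rowP => i; rewrite [LHS]mxE [RHS]mxE.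
  rewrite -(insert_widen t x _ (leqnSn n)); congr (_ 0 _).
  exact: ord_inj.
have {nj}jE : j = n by apply/eqP; rewrite eqn_leq nj -ltnS jn.
subst j; apply: filterS AP => x Px; apply: filterE => t.
congr (P _): Px; apply/rowP => i; rewrite mxE.
by rewrite (_ : widen_ord _ i = widen_ord (leqnSn n) i) ?insert_widen //; apply: ord_inj.
Qed.

Lemma coupling_layer_insert (R : realType) n
    (phi eta : forall j : 'I_n.+1, 'rV[R]_j -> R) t (x : 'rV[R]_n) :
  coupling_layer phi eta (insert ord_max t x) =
  insert ord_max (phi ord_max x * t + eta ord_max x)
    (coupling_layer (fun j => phi (widen_ord (leqnSn n) j))
                    (fun j => eta (widen_ord (leqnSn n) j)) x).
Proof.
apply/rowP => i; case: (unliftP ord_max i) => [j ->|->].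
  have -> : lift ord_max j = widen_ord (leqnSn n) j by apply: ord_inj; rewrite lift_max.
  by rewrite insert_widen [LHS]mxE [RHS]mxE before_widen insert_widen.
by rewrite insert_id mxE before_ord_max insert_id.
Qed.

(** When the coordinates before the last one are fixed, the last one undergoes an
    affine bijection of the line; the coordinates before it undergo a coupling
    layer of lower dimension. *)
Lemma AE_coupling_layer (R : realType) n
    (phi eta : forall j : 'I_n, 'rV[R]_j -> R) (P : set 'rV[R]_n) :
  (forall j, exists2 c, c != 0 & forall u, phi j u = c) ->
  AE P -> AE (fun x => P (coupling_layer phi eta x)).
Proof.
elim: n phi eta P => [|n IH] phi eta P phiE /=.
  by have -> : coupling_layer phi eta 0 = 0 by apply/rowP => -[].
have phiE' (j : 'I_n) : exists2 c, c != 0 &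
  forall u, phi (widen_ord (leqnSn n) j) u = c by exact: phiE.
move=> /(IH _ (fun j => eta (widen_ord (leqnSn n) j)) _ phiE').
apply: filterS => x; have [c c0 cE] := phiE ord_max.
move=> /(aeR_comp_affine (eta ord_max x) c0); apply: filterS => t.
by rewrite coupling_layer_insert cE.
Qed.

(** The triangular system is solved from the first coordinate on. *)
Lemma coupling_layer_agree (R : realType) n (k : nat)
    (phi eta : forall j : 'I_n, 'rV[R]_j -> R) (x y : 'rV[R]_n) :
  (forall j : 'I_n, (j < k)%N -> exists2 c, c != 0 & forall u, phi j u = c) ->
  (forall j : 'I_n, (j < k)%N ->
     coupling_layer phi eta x 0 j = coupling_layer phi eta y 0 j) ->
  forall j : 'I_n, (j < k)%N -> x 0 j = y 0 j.
Proof.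
move=> phiE Gxy j; have [m] := ubnP j; elim: m j => // m IH j jm jk.
have [c c0 cE] := phiE j jk; have := Gxy j jk; rewrite !mxE !cE.
have -> : before j x = before j y.
  apply/rowP => i; rewrite !mxE; apply: IH.
    exact: leq_trans (ltn_ord i) jm.
  exact: ltn_trans (ltn_ord i) jk.
by move/addIr/(mulfI c0).
Qed.

Lemma coupling_layer_inj (R : realType) n
    (phi eta : forall j : 'I_n, 'rV[R]_j -> R) :
  (forall j, exists2 c, c != 0 & forall u, phi j u = c) ->
  injective (coupling_layer phi eta).
Proof.
move=> phiE x y Gxy; apply/rowP => j.
by apply: (@coupling_layer_agree R n n phi eta) => // i _; rewrite Gxy.
Qed.

(** If phi_j is the first scale to vanish, the first j entries of the output
    determine those of the input, hence also output j, which can then not take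
    the two values 0 and 1 while the former are 0. *)
Lemma coupling_layer_surj_neq0 (R : realType) n
    (phi eta : forall j : 'I_n, 'rV[R]_j -> R) :
  (forall j, exists c, forall u, phi j u = c) ->
  (forall y, exists x, coupling_layer phi eta x = y) ->
  forall j, exists2 c, c != 0 & forall u, phi j u = c.
Proof.
move=> phiE Gsurj j; have [m] := ubnP j; elim: m j => // m IH j jm.
have [c cE] := phiE j; exists c => //; apply/eqP => c0.
have [x xE] := Gsurj 0; have [y yE] := Gsurj (delta_mx 0 j).
have agree (i : 'I_n) : (i < j)%N -> x 0 i = y 0 i.
  apply: (@coupling_layer_agree R n j phi eta) => [i' ij|i' ij].
    by apply: IH; exact: leq_trans ij jm.
  by rewrite xE yE !mxE (_ : i' == j = false) ?andbF //; apply: ltn_eqF.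
have : coupling_layer phi eta x 0 j = coupling_layer phi eta y 0 j.
  rewrite !mxE !cE c0 !mul0r !add0r; congr (eta j _).
  apply/rowP => i; rewrite !mxE; apply: agree; exact: (ltn_ord i).
by rewrite xE yE !mxE !eqxx => /esym/eqP; rewrite oner_eq0.
Qed.

Lemma coupling_layer_lipschitz (R : realType) n
    (phi eta : forall j : 'I_n, 'rV[R]_j -> R) :
  (forall j, exists c, forall u, phi j u = c) -> (forall j, lipschitz (eta j)) ->
  exists2 K, 0 <= K &
    forall x y, `|coupling_layer phi eta x - coupling_layer phi eta y| <= K * `|x - y|.
Proof.
move=> phiE etaL; have [c cE] := choice phiE.
have /choice[L LP] : forall j, exists L : R, 0 <= L /\
    forall x y, `|eta j x - eta j y| <= L * `|x - y|.
  by move=> j; have [L ? ?] := lipschitz_exists (etaL j); exists L.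
have L0 j : 0 <= L j by have [] := LP j.
have K0 : 0 <= \sum_j (`|c j| + L j) by apply: sumr_ge0 => j _; rewrite addr_ge0.
exists (\sum_j (`|c j| + L j)) => // x y.
apply: rV_norm_le => [|j]; first by rewrite mulr_ge0.
apply: le_trans (_ : _ <= (`|c j| + L j) * `|x - y|) _; last first.
  apply: ler_wpM2r => //; rewrite (bigD1 j) //= lerDl.
  by apply: sumr_ge0 => i _; rewrite addr_ge0.
rewrite !mxE !cE opprD addrACA -mulrBr (le_trans (ler_normD _ _)) // mulrDl.
rewrite normrM lerD //.
  by apply: ler_wpM2l => //; have := rV_entry_le (x - y) j; rewrite !mxE.
have [_ H] := LP j; apply: le_trans (H _ _) _; apply: ler_wpM2l => //.
exact: before_dist.
Qed.

Lemma lipschitz_rV_continuous (R : realType) n m (G : 'rV[R]_n -> 'rV[R]_m) (K : R) :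
  0 <= K -> (forall x y, `|G x - G y| <= K * `|x - y|) -> continuous G.
Proof.
move=> K0 GK x P /nbhs_normP[e /= e0 HP].
have K1 : 0 < K + 1 by lra.
suff : \forall y \near x, P (G y) by [].
apply/nbhs_normP; exists (e / (K + 1)); first exact: divr_gt0.
move=> y /=; rewrite ltr_pdivlMr // => xy; apply: HP; apply: le_lt_trans (GK _ _) _.
have := normr_ge0 (x - y); nra.
Qed.

Lemma coupling_layer_ae_affine (R : realType) n
    (phi eta : forall j : 'I_n, 'rV[R]_j -> R) (j : 'I_n) :
  (forall j, exists c, forall u, phi j u = c) -> ae_affine (eta j) ->
  ae_affine (fun x => coupling_layer phi eta x 0 j).
Proof.
move=> phiE etaA; have [c cE] := phiE j.
have -> : (fun x => coupling_layer phi eta x 0 j) =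
    (fun x => c * x 0 j + eta j (before j x)).
  by apply/funext => x; rewrite mxE cE.
apply: ae_affine_add_coord; apply: ae_affine_comp etaA _ _ _.
- by apply: (lipschitz_rV_continuous (K := 1)) => // x y; rewrite mul1r before_dist.
- exact: AE_before.
- move=> i; rewrite (_ : (fun x => _) = fun x : 'rV[R]_n =>
    x 0 (widen_ord (ltnW (ltn_ord j)) i)); last by apply/funext => x; rewrite mxE.
  exact: ae_affine_coord.
Qed.

(** * Piecewise constant partial derivatives *)

(** A partial derivative that is c off a null set gives increments with slope c,
    on almost every line by [lipschitz_ae_derive_cst] and on all lines by density. *)
Lemma line_increment (R : realType) n (f : 'rV[R]_n.+1 -> R) (K c e t0 : R)
    (N : set 'rV[R]_n.+1) (k : 'I_n.+1) (x0 : 'rV[R]_n) :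
  (forall x y, `|f x - f y| <= K * `|x - y|) -> lebesgue_null N ->
  (forall t x, `|t0 - t| < e -> `|x0 - x| < e -> ~ N (insert k t x) ->
     derivable f (insert k t x) (delta_mx 0 k) /\ partial f k (insert k t x) = c) ->
  forall x t u, `|x0 - x| < e -> `|t0 - t| < e -> `|t0 - u| < e ->
    f (insert k u x) - f (insert k t x) = c * (u - t).
Proof.
move=> fK /(lebesgue_null_AE_line k) AN fc x.
have le_case t u : `|x0 - x| < e -> `|t0 - t| < e ->
    `|t0 - u| < e -> t <= u -> f (insert k u x) - f (insert k t x) = c * (u - t).
  move=> xe te ue tu; apply: (AE_line_increment fK AN xe) => y Ny ye.
  apply: (lipschitz_ae_derive_cst (g := fun s => f (insert k s y)) (K := K)) => //.
    move=> s s'; apply: le_trans (fK _ _) _.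
    by apply: (ler_wpM2l (lipschitz_ge0 fK)); exact: insert_dist_l.
  apply: filterS Ny => s Ns tsu; rewrite derivable_insert derive_insert.
  by apply: fc => //; move: te ue; rewrite !ltr_distlC; lra.
move=> t u xe te ue; have [tu|/ltW ut] := leP t u; first exact: le_case.
by rewrite -opprB le_case // -mulrN opprB.
Qed.

(** Around a point that is in an open piece for each of the partial derivatives,
    all of them are a.e. constant, and f is affine there: go from x to y by
    changing one coordinate at a time and use [line_increment]. *)
Lemma piecewise_constant_ae_affine (R : realType) n (f : 'rV[R]_n -> R) :
  lipschitz f -> (forall r, lebesgue_null (~` derivable_partial f r)) ->
  (forall r, piecewise_constant (derivable_partial f r) (partial f r)) ->
  ae_affine f.
Proof.
case: n f => [|n] f /lipschitz_exists[K K0 fK] fnull fpc.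
  exists setT; first exact: filterT.
  move=> x0; exists [::]; apply: filterE => x _; exists 0; first by case.
  apply: filterE => y; rewrite mulmx0 mxE addr0; congr f.
  by apply/rowP => -[].
have fpc' r : exists Pc : (nat -> set 'rV[R]_n.+1) * (nat -> R),
    [/\ forall m, open (Pc.1 m), locally_finite Pc.1,
        lebesgue_null (~` \bigcup_m Pc.1 m) &
        forall m x, Pc.1 m x -> derivable_partial f r x -> partial f r x = Pc.2 m].
  by have [P [c ?]] := fpc r; exists (P, c).
have [Pc PcP] := choice fpc'.
pose P r := (Pc r).1; pose c r := (Pc r).2.
exists (fun x => forall r, exists m, P r m x).
  apply: filter_forall => r; have [_ _ nullP _] := PcP r.
  by apply: filterS (lebesgue_null_AE nullP) => x /= /contrapT[m _ Pm]; exists m.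
move=> x0.
have finU r : exists s : seq nat, \forall x \near x0, forall m, P r m x -> m \in s.
  have [_ lf _ _] := PcP r; have [U xU /finite_seqP[s sE]] := lf x0.
  exists s; apply: filterS xU => x Ux m Pm.
  have : [set m | P r m `&` U !=set0] m by exists x.
  by rewrite /P sE.
have [s sP] := choice finU.
exists (flatten [seq map (c r) (s r) | r : 'I_n.+1]).
have near_s : \forall x \near x0, forall r m, P r m x -> m \in s r.
  by apply: (filter_forall (nbhs_filter x0)) => r; exact: sP.
apply: filterS near_s => x xs Wx.
have [m mP] := choice Wx.
exists (\col_r c r (m r)).
  move=> r; rewrite mxE; apply/flattenP; exists (map (c r) (s r)).
    by apply: map_f; rewrite mem_enum.
  by apply: map_f; apply: xs.
have near_P : \forall y \near x, forall r, P r (m r) y.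
  apply: (filter_forall (nbhs_filter x)) => r.
  by have [Po _ _ _] := PcP r; apply: open_nbhs_nbhs; split; [exact: Po|exact: mP].
case/nbhs_normP: near_P => e /= e0 He.
apply/nbhs_normP; exists e => // y /= xy.
(* the path from x to y: z k has the first k coordinates of y *)
pose z k : 'rV[R]_n.+1 := \row_i if (i < k)%N then y 0 i else x 0 i.
have z0 : z 0%N = x by apply/rowP => i; rewrite mxE.
have zn : z n.+1 = y by apply/rowP => i; rewrite mxE ltn_ord.
apply/eqP; rewrite addrC -subr_eq; apply/eqP.
rewrite -{1}zn -{1}z0 -(telescope_sumr (fun k => f (z k))) // big_mkord mxE.
apply: eq_bigr => r _; rewrite !mxE.
pose w := \row_i z r 0 (lift r i).
have zr : z r = insert r (x 0 r) w.
  by rewrite [LHS](insert_surj r) [z r 0 r]mxE ltnn.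
have zr1 : z r.+1 = insert r (y 0 r) w.
  rewrite [LHS](insert_surj r) [z r.+1 0 r]mxE ltnSn; congr insert.
  apply/rowP => i; rewrite !mxE [in LHS]ltnS leq_eqVlt.
  have -> : (lift r i == r :> nat) = false by rewrite eq_sym; apply/negbTE/neq_lift.
  by [].
rewrite zr zr1 mulrC.
pose x' : 'rV[R]_n := \row_i x 0 (lift r i).
have x'E : x = insert r (x 0 r) x' by exact: insert_surj.
apply: (@line_increment _ _ _ K (c r (m r)) e (x 0 r)
  (~` derivable_partial f r) r x') => //.
- move=> t v te ve /contrapT dv; split; first exact: dv.
  have [_ _ _ cP] := PcP r; apply: cP dv; apply: He => /=.
  rewrite [in X in `|X - _|]x'E.
  by apply: le_lt_trans (insert_dist _ _ _ _ _) _; rewrite gt_max te ve.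
- apply: le_lt_trans xy; apply: rV_norm_le => // i; rewrite !mxE.
  case: ifP => _; last by rewrite subrr normr0.
  by have := rV_entry_le (x - y) (lift r i); rewrite !mxE.
- by rewrite subrr normr0.
- by apply: le_lt_trans xy; have := rV_entry_le (x - y) r; rewrite !mxE.
Qed.

(** * Compositions of coupling layers *)

(** What the induction on the number of layers carries: full sets can be pulled
    back along F, and F is Lipschitz with components in the class. *)
Definition ae_affine_map (R : realType) n (F : 'rV[R]_n -> 'rV[R]_n) : Prop :=
  [/\ forall P, AE P -> AE (fun x => P (F x)),
      exists2 K, 0 <= K & forall x y, `|F x - F y| <= K * `|x - y| &
      forall j, ae_affine (fun x => F x 0 j)].

(** The last layer is onto because the composition is; then its scales do not
    vanish, it is injective, and so the composition of the layers before it is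
    onto too. *)
Lemma compose_layers_ae_affine (R : realType) n k
    (phi eta : forall (i : 'I_k) (j : 'I_n), 'rV[R]_j -> R) (s : seq 'I_k)
    (F := foldl (fun y i => coupling_layer (phi i) (eta i) y) ^~ s) :
  (forall i j, exists c, forall u, phi i j u = c) ->
  (forall i j, lipschitz (eta i j)) -> (forall i j, ae_affine (eta i j)) ->
  (forall y, exists x, F x = y) ->
  ae_affine_map F.
Proof.
move=> phiE etaL etaA; rewrite {}/F; elim/last_ind: s => [|s i IH] surj.
  split=> //; last exact: ae_affine_coord.
  by exists 1 => // x y; rewrite mul1r.
pose F x := foldl (fun y i => coupling_layer (phi i) (eta i) y) x s.
pose G := coupling_layer (phi i) (eta i).
have FE x : foldl (fun y i => coupling_layer (phi i) (eta i) y) x (rcons s i) = G (F x).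
  by rewrite foldl_rcons.
have Gsurj y : exists x, G x = y.
  by have [x xy] := surj y; exists (F x); rewrite -FE.
have phi0 := coupling_layer_surj_neq0 (phiE i) Gsurj.
have Fsurj y : exists x, F x = y.
  have [x] := surj (G y); rewrite FE => /(coupling_layer_inj phi0) <-.
  by exists x.
have [FAE [K K0 FK] Faff] : ae_affine_map F := IH Fsurj.
have [L L0 GL] := coupling_layer_lipschitz (phiE i) (etaL i).
split.
- move=> P /(AE_coupling_layer (eta i) phi0)/FAE; apply: filterS => x.
  by rewrite FE.
- exists (L * K); first exact: mulr_ge0.
  move=> x y; rewrite !FE (le_trans (GL _ _)) // -mulrA.
  exact: ler_wpM2l.
- move=> j; rewrite (_ : (fun x => _) = fun x => G (F x) 0 j); last first.
    by apply/funext => x; rewrite FE.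
  apply: (@ae_affine_comp _ _ _ (fun y => G y 0 j) F) => //.
    exact: coupling_layer_ae_affine.
  exact: lipschitz_rV_continuous FK.
Qed.

Lemma differentiable_compose_layers_affine (R : realType) n k
    (phi eta : forall (i : 'I_k) (j : 'I_n), 'rV[R]_j -> R) (F : 'rV[R]_n -> 'rV[R]_n) :
  (forall x, F x = compose_layers (fun i => coupling_layer (phi i) (eta i)) x) ->
  (forall x, differentiable F x) -> (forall y, exists x, F x = y) ->
  (forall i j, exists c, forall u, phi i j u = c) ->
  (forall i j, lipschitz (eta i j)) -> (forall i j, ae_affine (eta i j)) ->
  exists (A : 'M[R]_n) (b : 'rV[R]_n), forall x, F x = x *m A + b.
Proof.
move=> /funext FE Fdiff Fsurj phiE etaL etaA.
have [_ [K K0 FK] Faff] : ae_affine_map F.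
  by rewrite FE in Fsurj *; exact: compose_layers_ae_affine.
have /choice[a /choice[b abE]] : forall j, exists (a : 'cV[R]_n) (b : R),
    forall x, F x 0 j = (x *m a) 0 0 + b.
  move=> j; apply: (@affine_of_ae_affine R n (fun x => F x 0 j) K) => //.
    move=> x r; apply: diff_derivable.
    apply: (@differentiable_comp _ _ _ _ F (fun y : 'rV[R]_n => y 0 j)) => //.
    exact: differentiable_coord.
  move=> x y; apply: le_trans (FK x y).
  by have := rV_entry_le (F x - F y) j; rewrite !mxE.
exists (\matrix_(i, j) a j i 0), (\row_j b j) => x; apply/rowP => j.
rewrite abE !mxE; congr (_ + _); apply: eq_bigr => i _.
by rewrite mxE.
Qed.

(** * The log-density of an affine flow *)

(** The difference quotients of an affine map do not depend on the point. *)
Lemma jacobian_affine (R : realType) n (F : 'rV[R]_n -> 'rV[R]_n) (A : 'M[R]_n)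
    (b : 'rV[R]_n) :
  (forall x, F x = x *m A + b) -> (forall x, differentiable F x) ->
  forall x y, 'J F x = 'J F y.
Proof.
move=> FE Fdiff x y; apply/row_matrixP => r.
have E z : (fun h : R => h^-1 *: (F (h *: delta_mx 0 r + z) - F z)) =
    (fun h : R => h^-1 *: (h *: delta_mx 0 r *m A)).
  by apply/funext => h; rewrite !FE mulmxDl opprD addrACA addrK subrr addr0.
have DE : 'D_(delta_mx 0 r) F x = 'D_(delta_mx 0 r) F y by rewrite /derive !E.
have J z : row r ('J F z) = 'D_(delta_mx 0 r) F z.
  exact: etrans (rowE r _) (esym (deriveEjacobian _ (Fdiff z))).
exact: etrans (J x) (etrans DE (esym (J y))).
Qed.

Lemma derive_quadratic_line (R : realType) n (f : 'rV[R]_n -> R) (x v : 'rV[R]_n)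
    (p q : R) :
  (forall h : R, f (h *: v + x) = f x + p * h + q * h ^+ 2) -> 'D_v f x = p.
Proof.
move=> fE; rewrite /derive.
have -> : (fun h : R => h^-1 *: (f (h *: v + x) - f x)) =
  (fun h : R => h^-1 *: ((fun h => p * h + q * h ^+ 2) (h *: 1 + 0) -
                         (fun h => p * h + q * h ^+ 2) 0)).
  apply/funext => h; rewrite fE; congr (_ *: _).
  by rewrite [h *: 1]mulr1 addr0; ring.
rewrite -/(derive (fun h : R => p * h + q * h ^+ 2) 0 1).
have Did := is_derive_id (0 : R) (1 : R).
have := is_deriveD (is_deriveZ p Did) (is_deriveZ q (is_deriveX 2 Did)).
rewrite /= expr1 mulr0 scale0r scaler0 addr0 [p *: 1]mulr1 => D.
by have [_] := D.
Qed.

Lemma standard_normal_densityE (R : realType) n : exists2 C : R, 0 < C &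
  forall z : 'rV[R]_n, standard_normal_density z = C * expR (- \sum_j z 0 j ^+ 2 / 2).
Proof.
exists (normal_peak 1 ^+ n); first by rewrite exprn_gt0 // normal_peak_gt0 // oner_neq0.
move=> z; rewrite /standard_normal_density -sumrN expR_sum.
rewrite -[in _ ^+ n](card_ord n) -prodr_const -big_split /=.
apply: eq_bigr => j _; rewrite normal_pdfE ?oner_neq0 // /normal_fun.
by rewrite subr0 expr1n mulNr.
Qed.

Lemma gradient_gaussian_affine (R : realType) n (A : 'M[R]_n) (b : 'rV[R]_n)
    (f : 'rV[R]_n -> R) (c : R) :
  (forall x, f x = c - \sum_j (x *m A + b) 0 j ^+ 2 / 2) ->
  forall x, gradient f x = - ((x *m A + b) *m A^T).
Proof.
move=> fE x; apply/rowP => r; rewrite mxE.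
pose q := \sum_j A r j ^+ 2.
apply: (@derive_quadratic_line _ _ _ _ _ _ (- q / 2)) => h.
have zE j : ((h *: delta_mx 0 r + x) *m A + b) 0 j =
    (x *m A + b) 0 j + h * A r j.
  rewrite mulmxDl -scalemxAl -rowE -addrA addrC.
  by rewrite mxE; congr (_ + _); rewrite !mxE.
rewrite !fE.
have -> : (- ((x *m A + b) *m A^T)) 0 r = - \sum_j (x *m A + b) 0 j * A r j.
  by rewrite mxE mxE; congr (- _); apply: eq_bigr => j _; rewrite [A^T j r]mxE.
have -> : \sum_j ((h *: delta_mx 0 r + x) *m A + b) 0 j ^+ 2 / 2 =
    \sum_j (x *m A + b) 0 j ^+ 2 / 2 +
    ((\sum_j (x *m A + b) 0 j * A r j) * h + q * (h ^+ 2 / 2)).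
  rewrite /q !mulr_suml -!big_split /=; apply: eq_bigr => j _.
  by rewrite zE; field.
by rewrite !opprD !mulNr !addrA mulrA [q * _ / 2]mulrAC.
Qed.

Lemma lipschitz_affine (R : realType) n (g : 'rV[R]_n -> 'rV[R]_n) (M : 'M[R]_n)
    (b : 'rV[R]_n) :
  (forall x, g x = x *m M + b) -> lipschitz g.
Proof.
move=> gE; pose K := \sum_i \sum_j `|M i j|.
have K0 : 0 <= K by apply: sumr_ge0 => i _; apply: sumr_ge0.
exists K; split; first exact: num_real.
move=> L KL [x y] _ /=; apply: le_trans (_ : _ <= K * `|x - y|) _; last first.
  by apply: ler_wpM2r => //; exact: ltW.
rewrite !gE opprD addrACA subrr addr0 -mulmxBl.
apply: rV_norm_le => [|j]; first exact: mulr_ge0.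
rewrite mxE (le_trans (ler_norm_sum _ _ _)) // mulr_suml.
apply: ler_sum => i _; rewrite normrM mulrC.
apply: ler_pM => //; last exact: rV_entry_le.
by rewrite (bigD1 j) //= lerDl; apply: sumr_ge0.
Qed.

(** If the constant Jacobian determinant is 0, the density is 0 and its logarithm
    is constant; otherwise it is the logarithm of a Gaussian density composed
    with an affine map. *)
Lemma lipschitz_grad_log_flow_density_affine (R : realType) n (F : 'rV[R]_n -> 'rV[R]_n)
   (A : 'M[R]_n) (b : 'rV[R]_n) :
  (forall x, F x = x *m A + b) -> (forall x, differentiable F x) ->
  lipschitz (gradient (fun x => ln (flow_density (@standard_normal_density R n) F x))).
Proof.
move=> FE Fdiff; have Jcst := jacobian_affine FE Fdiff.
have [C C0 qE] := standard_normal_densityE R n.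
have [D DE] : exists D, forall x, `|\det ('J F x)| = D.
  by exists `|\det ('J F 0)| => x; rewrite (Jcst x 0).
have [D0|Dneq0] := eqVneq D 0.
  have L0 y : ln (flow_density (@standard_normal_density R n) F y) = ln 0.
    by rewrite /flow_density DE D0 mulr0.
  rewrite (funext L0).
  apply: (@lipschitz_affine _ _ _ 0 0) => x; rewrite mulmx0 addr0.
  apply/rowP => r; rewrite mxE [RHS]mxE; apply: (@derive_quadratic_line _ _ _ _ _ _ 0) => h.
  by rewrite !mul0r !addr0.
have Dgt0 : 0 < D by rewrite lt_neqAle eq_sym Dneq0 -(DE 0) normr_ge0.
have gradE := @gradient_gaussian_affine R n A b
   (fun x => ln (flow_density (@standard_normal_density R n) F x)) (ln (C * D)).
apply: (@lipschitz_affine _ _ _ (- (A *m A^T)) (- (b *m A^T))) => x.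
rewrite gradE; first by rewrite mulmxDl opprD mulmxN mulmxA.
move=> y; rewrite /flow_density DE qE mulrAC.
by rewrite [LHS]lnM ?posrE ?expR_gt0 ?mulr_gt0 // expRK FE.
Qed.

Theorem proposition3p9 (R : realType) (d k : nat)
    (T Tinv : 'rV[R]_d -> 'rV[R]_d)
    (phi eta : forall (i : 'I_k) (j : 'I_d), 'rV[R]_j -> R)
    (TK : cancel T Tinv) (TinvK : cancel Tinv T)
    (T_diff : forall z : 'rV[R]_d, differentiable T z)
    (Tinv_diff : forall x : 'rV[R]_d, differentiable Tinv x)
    (TinvE : forall x,
       Tinv x = compose_layers (fun i => coupling_layer (phi i) (eta i)) x)
    (log_q_diff : forall x : 'rV[R]_d,
       differentiable
         (fun y => ln (flow_density (@standard_normal_density R d) Tinv y)) x)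
    (phi_cst : forall i j, exists c : R, forall u, phi i j u = c)
    (eta_lip : forall i j, lipschitz (eta i j))
    (eta_partial_ae : forall i (j : 'I_d) (r : 'I_j),
       lebesgue_null (~` derivable_partial (eta i j) r))
    (eta_partial_pc : forall i (j : 'I_d) (r : 'I_j),
       piecewise_constant (derivable_partial (eta i j) r) (partial (eta i j) r)) :
  lipschitz (gradient
    (fun x => ln (flow_density (@standard_normal_density R d) Tinv x))).
Proof.
have etaA i j : ae_affine (eta i j).
  apply: piecewise_constant_ae_affine; [exact: eta_lip|exact: eta_partial_ae|].
  exact: eta_partial_pc.
have Tinv_surj y : exists x, Tinv x = y by exists (T y).
have [A [b TinvA]] :=
  differentiable_compose_layers_affine TinvE Tinv_diff Tinv_surj phi_cst eta_lip etaA.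
exact: lipschitz_grad_log_flow_density_affine TinvA Tinv_diff.
Qed.
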